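(* Let $G$ be a group of order $64$ admitting a diagonal double Kodaira structure. Then the following holds. (1) If $G$ is non-monolithic, then $G$ is isomorphic to $G(64, t)$ for some $t \in \{199, 200, 201, 264, 265\}$. (2) If $G$ is monolithic, then $G$ is isomorphic to $G(64, t)$ for some $t \in \{249, 266\}$.
   Context: Notation: $G(m,t)$ denotes the $t$-th group of order $m$ in the GAP4 database of small groups (SmallGroup library). For a finite group $G$, $\operatorname{mon}(G)$ is the intersection of all non-trivial normal subgroups of $G$; $G$ is called monolithic if $\operatorname{mon}(G)\neq\{1\}$, and non-monolithic otherwise. Commutators are $[x,y]=xyx^{-1}y^{-1}$, and $o(x)$ is the order of $x$. Diagonal double Kodaira structures. Let $G$ be a finite group and $b,n\ge 2$ integers. A diagonal double Kodaira structure of type $(b,n)$ on $G$ is an ordered tuple $\mathfrak{S}=(\mathsf r_{11},\mathsf t_{11},\ldots,\mathsf r_{1b},\mathsf t_{1b},\mathsf r_{21},\mathsf t_{21},\ldots,\mathsf r_{2b},\mathsf t_{2b},\mathsf z)$ of $4b+1$ elements generating $G$, with $o(\mathsf z)=n$, such that the following relations hold for all $j,k\in\{1,\ldots,b\}$. Surface relations: $[\mathsf r_{1b}^{-1},\mathsf t_{1b}^{-1}]\,\mathsf t_{1b}^{-1}\,[\mathsf r_{1\,b-1}^{-1},\mathsf t_{1\,b-1}^{-1}]\,\mathsf t_{1\,b-1}^{-1}\cdots[\mathsf r_{11}^{-1},\mathsf t_{11}^{-1}]\,\mathsf t_{11}^{-1}\,(\mathsf t_{11}\mathsf t_{12}\cdots\mathsf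 t_{1b})=\mathsf z$; $[\mathsf r_{21}^{-1},\mathsf t_{21}]\,\mathsf t_{21}\,[\mathsf r_{22}^{-1},\mathsf t_{22}]\,\mathsf t_{22}\cdots[\mathsf r_{2b}^{-1},\mathsf t_{2b}]\,\mathsf t_{2b}\,(\mathsf t_{2b}^{-1}\mathsf t_{2\,b-1}^{-1}\cdots\mathsf t_{21}^{-1})=\mathsf z^{-1}$. Conjugacy action of $\mathsf r_{1j}$: $[\mathsf r_{1j},\mathsf r_{2k}]=1$ if $j<k$; $[\mathsf r_{1j},\mathsf r_{2j}]=1$; $[\mathsf r_{1j},\mathsf r_{2k}]=\mathsf z^{-1}\mathsf r_{2k}\mathsf r_{2j}^{-1}\mathsf z\,\mathsf r_{2j}\mathsf r_{2k}^{-1}$ if $j>k$; $[\mathsf r_{1j},\mathsf t_{2k}]=1$ if $j<k$; $[\mathsf r_{1j},\mathsf t_{2j}]=\mathsf z^{-1}$; $[\mathsf r_{1j},\mathsf t_{2k}]=[\mathsf z^{-1},\mathsf t_{2k}]$ if $j>k$; $[\mathsf r_{1j},\mathsf z]=[\mathsf r_{2j}^{-1},\mathsf z]$. Conjugacy action of $\mathsf t_{1j}$: $[\mathsf t_{1j},\mathsf r_{2k}]=1$ if $j<k$; $[\mathsf t_{1j},\mathsf r_{2j}]=\mathsf t_{2j}^{-1}\mathsf z\,\mathsf t_{2j}$; $[\mathsf t_{1j},\mathsf r_{2k}]=[\mathsf t_{2j}^{-1},\mathsf z]$ if $j>k$; $[\mathsf t_{1j},\mathsf t_{2k}]=1$ if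 $j<k$; $[\mathsf t_{1j},\mathsf t_{2j}]=[\mathsf t_{2j}^{-1},\mathsf z]$; $[\mathsf t_{1j},\mathsf t_{2k}]=\mathsf t_{2j}^{-1}\mathsf z\,\mathsf t_{2j}\mathsf z^{-1}\mathsf t_{2k}\mathsf z\,\mathsf t_{2j}^{-1}\mathsf z^{-1}\mathsf t_{2j}\mathsf t_{2k}^{-1}$ if $j>k$; $[\mathsf t_{1j},\mathsf z]=[\mathsf t_{2j}^{-1},\mathsf z]$. A group admits a diagonal double Kodaira structure if it admits one of some type $(b,n)$ with $b,n\geq 2$. *)

(* Defs.v *)
From mathcomp Require Import all_boot all_fingroup.

Set Implicit Arguments.
Unset Strict Implicit.
Unset Printing Implicit Defensive.

Local Open Scope group_scope.

(* The leading G makes the empty intersection (G trivial) equal to G.         *)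
Definition mon (gT : finGroupType) (G : {group gT}) : {set gT} :=
  G :&: \bigcap_(N : {group gT} | (N <| G) && (N :!=: 1)) N.

Definition monolithic (gT : finGroupType) (G : {group gT}) : bool :=
  mon G != 1.

(* Not the library commutator [~ x, y] = x^-1 * y^-1 * x * y.                 *)
Definition lcomm (gT : finGroupType) (x y : gT) : gT := x * y * x^-1 * y^-1.

(* The indices 1, ..., b are represented by 'I_b; products over 'I_b are in   *)
(* increasing order of the index, and rev_ord turns them into decreasing      *)
(* ones.                                                                      *)
Record diagonal_dks (gT : finGroupType) (G : {group gT}) (b n : nat)
    (r1 t1 r2 t2 : 'I_b -> gT) (z : gT) : Prop := DiagonalDKS {
  dks_b_ge2 : 1 < b;
  dks_n_ge2 : 1 < n;
  dks_gen :
    <<[set r1 j | j : 'I_b] :|: [set t1 j | j : 'I_b]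
      :|: [set r2 j | j : 'I_b] :|: [set t2 j | j : 'I_b] :|: [set z]>> = G;
  dks_order : #[z] = n;
  dks_surface1 :
    (\prod_(j < b) (lcomm (r1 (rev_ord j))^-1 (t1 (rev_ord j))^-1
                    * (t1 (rev_ord j))^-1))
    * (\prod_(j < b) t1 j) = z;
  dks_surface2 :
    (\prod_(j < b) (lcomm (r2 j)^-1 (t2 j) * t2 j))
    * (\prod_(j < b) (t2 (rev_ord j))^-1) = z^-1;
  dks_r1r2_lt : forall j k : 'I_b, j < k -> lcomm (r1 j) (r2 k) = 1;
  dks_r1r2_eq : forall j : 'I_b, lcomm (r1 j) (r2 j) = 1;
  dks_r1r2_gt : forall j k : 'I_b, k < j ->
    lcomm (r1 j) (r2 k) = z^-1 * r2 k * (r2 j)^-1 * z * r2 j * (r2 k)^-1;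
  dks_r1t2_lt : forall j k : 'I_b, j < k -> lcomm (r1 j) (t2 k) = 1;
  dks_r1t2_eq : forall j : 'I_b, lcomm (r1 j) (t2 j) = z^-1;
  dks_r1t2_gt : forall j k : 'I_b, k < j ->
    lcomm (r1 j) (t2 k) = lcomm z^-1 (t2 k);
  dks_r1z : forall j : 'I_b, lcomm (r1 j) z = lcomm (r2 j)^-1 z;
  dks_t1r2_lt : forall j k : 'I_b, j < k -> lcomm (t1 j) (r2 k) = 1;
  dks_t1r2_eq : forall j : 'I_b, lcomm (t1 j) (r2 j) = (t2 j)^-1 * z * t2 j;
  dks_t1r2_gt : forall j k : 'I_b, k < j ->
    lcomm (t1 j) (r2 k) = lcomm (t2 j)^-1 z;
  dks_t1t2_lt : forall j k : 'I_b, j < k -> lcomm (t1 j) (t2 k) = 1;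
  dks_t1t2_eq : forall j : 'I_b, lcomm (t1 j) (t2 j) = lcomm (t2 j)^-1 z;
  dks_t1t2_gt : forall j k : 'I_b, k < j ->
    lcomm (t1 j) (t2 k) =
      (t2 j)^-1 * z * t2 j * z^-1 * t2 k * z * (t2 j)^-1 * z^-1 * t2 j
      * (t2 k)^-1;
  dks_t1z : forall j : 'I_b, lcomm (t1 j) z = lcomm (t2 j)^-1 z
}.

Definition admits_diagonal_dks (gT : finGroupType) (G : {group gT}) : Prop :=
  exists (b n : nat) (r1 t1 r2 t2 : 'I_b -> gT) (z : gT),
    diagonal_dks G n r1 t1 r2 t2 z.

(* isog_G64 G t : the group G is isomorphic to G(64, t), the t-th group of    *)
(* order 64 in the SmallGroup library, for the seven values of t below (and   *)
(* False for the others).  Every group is generated by commuting subgroups:   *)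
(* D = <x, y>, dihedral or quaternion of order 8, C = <u, v> and, in the last *)
(* three cases, a cyclic <w>; D and C share the derived subgroup {1, [x, y]}. *)
(* With o for a central product this gives                                    *)
(*   199 : D_8 o (C_2^2 : C_4)           200 : Q_8 o (C_2^2 : C_4)            *)
(*   201 : D_8 o (C_4 : C_4)             249 : Q_8 o M_4(2), M_4(2) modular   *)
(*   264 : (D_8 o D_8) x C_2             265 : (D_8 o Q_8) x C_2              *)
(*   266 : (D_8 o D_8) o C_4                                                  *)
(* Among the groups of order 64 with derived subgroup of order 2 and central  *)
(* quotient C_2^4, they are told apart by abelianization (C_4 x C_2^3 for 199,*)
(* 200, 201, 249 and C_2^5 for 264, 265, 266), centre (C_4 for 249 and 266,   *)
(* C_2^2 for the others) and number of involutions (23, 7, 15, 15, 39, 23, 31 *)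
(* respectively).                                                             *)
Inductive isog_G64 (gT : finGroupType) (G : {group gT}) : nat -> Prop :=
| G64_199 of G \isog Grp (x : y : u : v :
    (x ^+ 2, y ^+ 2, (x * y) ^+ 4, u ^+ 4, v ^+ 2, [~ u, v] = [~ x, y],
     [~ x, u], [~ x, v], [~ y, u], [~ y, v])) : isog_G64 G 199
| G64_200 of G \isog Grp (x : y : u : v :
    (x ^+ 4, y ^+ 2 = x ^+ 2, [~ x, y] = x ^+ 2,
     u ^+ 4, v ^+ 2, [~ u, v] = [~ x, y],
     [~ x, u], [~ x, v], [~ y, u], [~ y, v])) : isog_G64 G 200
| G64_201 of G \isog Grp (x : y : u : v :
    (x ^+ 2, y ^+ 2, (x * y) ^+ 4,
     u ^+ 4, v ^+ 2 = [~ x, y], [~ u, v] = [~ x, y],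
     [~ x, u], [~ x, v], [~ y, u], [~ y, v])) : isog_G64 G 201
| G64_249 of G \isog Grp (x : y : u : v :
    (x ^+ 4, y ^+ 2 = x ^+ 2, [~ x, y] = x ^+ 2,
     u ^+ 8, u ^+ 4 = [~ x, y], v ^+ 2, [~ u, v] = [~ x, y],
     [~ x, u], [~ x, v], [~ y, u], [~ y, v])) : isog_G64 G 249
| G64_264 of G \isog Grp (x : y : u : v : w :
    (x ^+ 2, y ^+ 2, (x * y) ^+ 4, u ^+ 2, v ^+ 2, [~ u, v] = [~ x, y],
     [~ x, u], [~ x, v], [~ y, u], [~ y, v],
     w ^+ 2, [~ x, w], [~ y, w], [~ u, w], [~ v, w])) : isog_G64 G 264
| G64_265 of G \isog Grp (x : y : u : v : w :
    (x ^+ 2, y ^+ 2, (x * y) ^+ 4,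
     u ^+ 2 = [~ x, y], v ^+ 2 = [~ x, y], [~ u, v] = [~ x, y],
     [~ x, u], [~ x, v], [~ y, u], [~ y, v],
     w ^+ 2, [~ x, w], [~ y, w], [~ u, w], [~ v, w])) : isog_G64 G 265
| G64_266 of G \isog Grp (x : y : u : v : w :
    (x ^+ 2, y ^+ 2, (x * y) ^+ 4, u ^+ 2, v ^+ 2, [~ u, v] = [~ x, y],
     [~ x, u], [~ x, v], [~ y, u], [~ y, v],
     w ^+ 2 = [~ x, y], [~ x, w], [~ y, w], [~ u, w], [~ v, w]))
  : isog_G64 G 266.

(* Main.v *)
Require Import Defs.
From mathcomp Require Import all_boot all_fingroup all_solvable.

(* If z is central, the relations say that the r_1j, t_1j and the r_2j, t_2j  *)
(* are dual to each other for the commutator pairing with values in <z>.  A   *)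
(* chain of centralizers then gives |G| >= #[z]^(2b+1), so b = 2 and z is an  *)
(* involution, and counting shows that G' = <z> and |Z(G)| <= 4.  If z is not *)
(* central, the same bound applied to a quotient by a term of the upper       *)
(* central series leaves only |Z(G)| = 2 and z in Z_2(G); then C_G(z) / Z(G)  *)
(* is abelian of index two in G / Z(G), which is impossible.  Hence G is a    *)
(* central product of two groups generated by hyperbolic pairs and of Z(G),   *)
(* and the square map, which is quadratic over the commutator form, tells the *)
(* seven possibilities apart after a change of symplectic basis.              *)

Set Implicit Arguments.
Unset Strict Implicit.
Unset Printing Implicit Defensive.

Local Open Scope group_scope.

(** * Central pairings *)

(** If [z] is central, every commutator of an [r1] or [t1] with an [r2] or [t2] is trivial, except
    at matching indices, where it generates [<[z]>]. So G carries 2b pairs dual under the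
    commutator, a [central_pairing] ([diagonal_dks_pairing]). Imposing commutation with one partner
    after another costs a factor #[z] each time ([central_pairing_chain]), whence |G| >=
    #[z]^(2b+1). Order 64 leaves b = 2, #[z] = 2, derived subgroup [<[z]>] and a centre of order at
    most 4 ([small_central_pairing], [diagonal_dks_structure]).

    That [z] is central is [diagonal_dks_central]: otherwise the same bounds hold modulo the last
    upper central term missing [z], and the centralizer of [z] yields there an abelian subgroup of
    index at most two, too large for them.

    The commutator is now an alternating form over the field of two elements with radical the
    centre, and squaring is quadratic over it. A noncommuting pair extends to a symplectic basis
    ([symplectic_quad_complete]), and the centre has order exactly 4. Changes of basis bring the
    squares to one of two normal forms if the centre is cyclic ([isog_G64_center4]), and to one of
    five otherwise ([isog_G64_center22]); [homg_quad_rels] identifies each form with its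
    presentation. Finally, G is monolithic exactly when its centre is cyclic. *)

Record central_pairing (gT : finGroupType) (H : {group gT}) (I : finType)
    (e f : I -> gT) (z : gT) : Prop := CentralPairing {
  cp_gen : <<[set e i | i : I] :|: [set f i | i : I] :|: [set z]>> = H;
  cp_center : z \in 'Z(H);
  cp_off : forall i j, i != j -> [~ e i, f j] = 1;
  cp_diag : forall i, <[ [~ e i, f i] ]> = <[z]>
}.

Section CentralPairing.

Variables (gT : finGroupType) (I : finType).
Implicit Types (A H : {group gT}) (e f : I -> gT) (z : gT).

Lemma central_pairing_sym H e f z :
  central_pairing H e f z -> central_pairing H f e z.
Proof.
case=> genH Zz off diag; split=> // [|i j ij|i].
- by rewrite (setUC [set f i | i : I]).
- by rewrite -invg_comm off ?invg1 // eq_sym.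
by rewrite -invg_comm cycleV.
Qed.

Lemma central_pairing_mem H e f z (i : I) :
  central_pairing H e f z -> [/\ e i \in H, f i \in H & z \in H].
Proof.
case=> <- _ _ _; split; apply: mem_gen; rewrite 2!in_setU.
- by rewrite imset_f.
- by rewrite (imset_f f) ?orbT.
by rewrite set11 orbT.
Qed.

Lemma central_pairing_commute H e f z (i : I) :
  central_pairing H e f z -> commute (e i) z /\ commute (f i) z.
Proof.
move=> cpH; have [He Hf _] := central_pairing_mem i cpH.
by have /setIP[_ /centP cz] := cp_center cpH; split; apply/commute_sym/cz.
Qed.

(* Each f i contributes a factor #[z]: conjugating it by the powers of e i,   *)
(* which centralize the other f j, yields the whole coset f i <z>.            *)
Lemma central_pairing_chain H e f z A (s : seq I) :
    central_pairing H e f z -> (forall i, e i \in A) -> uniq s ->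
  #[z] ^ size s * #|'C_A([set f i | i in s])| <= #|A|.
Proof.
move=> cpH Ae; elim: s => [|j s IHs] /=.
  by rewrite mul1n subset_leq_card ?subsetIl.
case/andP=> s'j /IHs; apply: leq_trans; set C := 'C_A([set f i | i in s]).
have{IHs} Ce: e j \in C.
  rewrite inE Ae; apply/centP=> _ /imsetP[i si ->].
  apply/commgP/eqP/(cp_off cpH); apply: contraNneq s'j => ->; exact: si.
have ->: 'C_A([set f i | i in j :: s]) = 'C_C[f j].
  rewrite /C -setIA -cent_set1 -centU; congr (_ :&: 'C(_)).
  apply/setP=> y; rewrite !inE; apply/imsetP/orP.
    case=> i; rewrite inE => /predU1P[->|si] ->; first by right.
    by left; apply: imset_f.
  case=> [/imsetP[i si ->]|/eqP->]; last by exists j; rewrite // inE eqxx.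
  by exists i; rewrite // inE si orbT.
rewrite expnS (mulnC #[z]) -mulnA leq_mul2l; apply/orP; right.
rewrite -(Lagrange (subsetIl C 'C[f j])) mulnC leq_mul2l; apply/orP; right.
rewrite index_cent1 /order -(card_lcoset <[z]> (f j)) subset_leq_card //.
apply/subsetP=> _ /lcosetP[t + ->].
rewrite -(cp_diag cpH j) -cycleV invg_comm => /cycleP[k ->].
have [cez _] := central_pairing_commute j cpH.
suffices ced: commute (e j) [~ f j, e j].
  rewrite -(commgX _ ced) commgEl mulKVg; apply: memJ_class; exact: groupX.
have /cycleP[m ->]: [~ f j, e j] \in <[z]>.
  by rewrite -(cp_diag cpH j) -cycleV invg_comm cycle_id.
exact: commuteX.
Qed.

Lemma card_central_pairing H e f z A :
    central_pairing H e f z -> (forall i, e i \in A) ->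
  #[z] ^ #|I| * #|'C_A([set f i | i : I])| <= #|A|.
Proof.
move=> cpH Ae; have := central_pairing_chain cpH Ae (enum_uniq I).
rewrite -cardE; congr (_ * #|'C_A(_)| <= _).
by apply/setP=> y; apply/imsetP/imsetP=> -[i _ ->]; exists i; rewrite ?mem_enum.
Qed.

Let gen_left e z : {group gT} := <<z |: [set e i | i : I]>>.

Lemma central_pairing_join H e f z :
  central_pairing H e f z -> gen_left e z <*> gen_left f z = H.
Proof.
move=> cpH; rewrite joing_idl joing_idr -(cp_gen cpH); congr <<_>>.
apply/setP=> y; rewrite ![y \in _ :|: _]in_setU !in_set1.
by case: (y == z); rewrite //= ?orbT ?orbF.
Qed.

Lemma central_pairing_normz H e f z : central_pairing H e f z -> <[z]> <| H.
Proof. by move=> cpH; rewrite sub_center_normal // cycle_subG (cp_center cpH). Qed.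

(** Modulo [<[z]>] the generators of one side commute with those of the other, so the two subgroups
    centralize each other there. *)
Lemma central_pairing_commg H e f z :
  central_pairing H e f z -> [~: gen_left e z, gen_left f z] \subset <[z]>.
Proof.
move=> cpH; have nzH := normal_norm (central_pairing_normz cpH).
have sJH := central_pairing_join cpH.
have nze : gen_left e z \subset 'N(<[z]>).
  by rewrite (subset_trans _ nzH) // -sJH joing_subl.
have nzf : gen_left f z \subset 'N(<[z]>).
  by rewrite (subset_trans _ nzH) // -sJH joing_subr.
rewrite -quotient_cents2 // (quotient_gen (subset_trans (subset_gen _) nze)).
rewrite (quotient_gen (subset_trans (subset_gen _) nzf)).
rewrite cent_gen gen_subG quotient_cents2r // gen_subG.
apply/subsetP=> _ /imset2P[a b Xa Yb ->].
case/setU1P: Xa => [->|/imsetP[i _ ->]]; case/setU1P: Yb => [->|/imsetP[j _ ->]].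
- by rewrite commgg group1.
- by have [_ /commute_sym/commgP/eqP->] := central_pairing_commute j cpH.
- by have [/commgP/eqP-> _] := central_pairing_commute i cpH.
have [<-|ij] := eqVneq i j; last by rewrite (cp_off cpH) ?group1.
by rewrite -cycle_subG (cp_diag cpH) subxx.
Qed.

Lemma central_pairing_cent_mem H e f z A :
    central_pairing H e f z -> z \in A -> z \in 'C_A([set f i | i : I]).
Proof.
move=> cpH Az; rewrite inE Az; apply/centP=> _ /imsetP[i _ ->].
by have [_ /commute_sym] := central_pairing_commute i cpH.
Qed.

(** One factor more than the chain of centralizers gives: [z] commutes with every [f i], so the last
    centralizer still contains [<[z]>]. *)
Lemma leq_card_central_pairing H e f z A :
    central_pairing H e f z -> (forall i, e i \in A) -> z \in A ->
  #[z] ^ #|I|.+1 <= #|A|.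
Proof.
move=> cpH Ae Az; rewrite expnSr (leq_trans _ (card_central_pairing cpH Ae)) //.
rewrite leq_mul2l subset_leq_card ?orbT // cycle_subG.
exact: central_pairing_cent_mem cpH Az.
Qed.

(* If A = <e, z> is proper, then it is so small that C_A(f) = <z>; the three  *)
(* subgroup lemma puts [A, A] inside it, so A / <z> is central of index two   *)
(* in H / <z>.                                                                *)
Lemma central_pairing_der1_proper H e f z :
    central_pairing H e f z -> #|H| <= 2 * #[z] ^ #|I|.+1 ->
  ~~ (H \subset gen_left e z) -> H^`(1) \subset <[z]>.
Proof.
move=> cpH leH; set A := gen_left e z => sHA'.
have nzH := normal_norm (central_pairing_normz cpH).
have defH := central_pairing_join cpH.
set B := gen_left f z in defH.
have sAH : A \subset H by rewrite -defH joing_subl.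
have sBH : B \subset H by rewrite -defH joing_subr.
have Ae i : e i \in A by rewrite mem_gen // setU1r // imset_f.
have Az : z \in A by rewrite mem_gen // setU11.
have indA : 1 < #|H : A| by rewrite indexg_gt1.
have leA := leq_card_central_pairing cpH Ae Az.
have oz_gt0 : 0 < #[z] ^ #|I| by rewrite expn_gt0 order_gt0.
have indA2 : #|H : A| = 2.
  apply/eqP; rewrite eqn_leq indA andbT.
  rewrite -(leq_pmul2l (cardG_gt0 A)) (Lagrange sAH) mulnC (leq_trans leH) //.
  by rewrite leq_mul2l leA orbT.
have leA2 : #|A| <= #[z] ^ #|I|.+1.
  by rewrite -(@leq_pmul2r 2) // -{1}indA2 (Lagrange sAH) mulnC.
have defC : 'C_A([set f i | i : I]) = <[z]>.
  apply/eqP; rewrite eq_sym eqEcard cycle_subG (central_pairing_cent_mem cpH Az) /=.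
  rewrite -(leq_pmul2l oz_gt0) (leq_trans (card_central_pairing cpH Ae)) //.
  by rewrite (leq_trans leA2) // expnSr.
have cABz : [~: A, B] \subset <[z]> := central_pairing_commg cpH.
have czA : <[z]> \subset 'C(A).
  rewrite cycle_subG; have /setIP[_] := cp_center cpH.
  by apply/subsetP; rewrite centS.
have cAAB : [~: A, A, B] = 1.
  apply: three_subgroup; apply/commG1P; last by rewrite (subset_trans _ czA) // commGC.
  exact: subset_trans czA.
have dA : A^`(1) \subset <[z]>.
  rewrite -defC subsetI der_sub; move/commG1P: cAAB => /subset_trans; apply.
  apply: centS; rewrite sub_gen //; apply: subsetUr.
have cAA := cABz; rewrite -quotient_cents2 ?(subset_trans _ nzH) // in cAA.
have cAH : A / <[z]> \subset 'C(H / <[z]>).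
  have nzA := subset_trans sAH nzH; have nzB := subset_trans sBH nzH.
  by rewrite -defH (quotientY nzA nzB) centY subsetI cAA quotient_cents2 ?dA.
apply: der1_min => //; apply: cyclic_center_factor_abelian.
set Q := (H / <[z]>)%G; have sAZ : A / <[z]> \subset 'Z(Q).
  by rewrite subsetI quotientS.
have: #|Q / 'Z(Q)| %| 2.
  rewrite card_quotient ?normal_norm ?center_normal // -[2]indA2.
  apply: dvdn_trans (indexgS _ sAZ) _.
  by rewrite index_quotient // (subset_trans (subsetIl _ _)).
rewrite /= dvdn_divisors // !inE => /orP[/eqP oQ|/eqP oQ].
  by rewrite (card1_trivg oQ) cyclic1.
by rewrite prime_cyclic // oQ.
Qed.

(** If both sides generate H, then H' is the commutator of the two sides. Otherwise one side is
    proper, and the previous lemma applies to the pairing or to its transpose. *)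
Lemma central_pairing_der1 H e f z :
    central_pairing H e f z -> #|H| <= 2 * #[z] ^ #|I|.+1 ->
  H^`(1) \subset <[z]>.
Proof.
move=> cpH leH; have cpH' := central_pairing_sym cpH.
have [sHA|] := boolP (H \subset gen_left e z); last first.
  exact: central_pairing_der1_proper cpH leH.
have [sHB|] := boolP (H \subset gen_left f z); last first.
  exact: central_pairing_der1_proper cpH' leH.
exact: subset_trans (commgSS sHA sHB) (central_pairing_commg cpH).
Qed.

Lemma card_center_central_pairing H e f z :
  central_pairing H e f z -> #[z] ^ #|I| * #|'Z(H)| <= #|H|.
Proof.
move=> cpH; have He i : e i \in H by have [] := central_pairing_mem i cpH.
apply: leq_trans (card_central_pairing cpH He); rewrite leq_mul2l.
rewrite subset_leq_card ?orbT // setIS // centS //.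
by apply/subsetP=> _ /imsetP[i _ ->]; have [] := central_pairing_mem i cpH.
Qed.


End CentralPairing.

(** * From diagonal double Kodaira structures to central pairings *)

Lemma commg_lcomm (gT : finGroupType) (x y : gT) :
  [~ x, y] = lcomm x y ^ (y * x).
Proof. by rewrite /lcomm /commg /conjg !invMg !mulgA !mulgKV. Qed.

Lemma lcomm_morph (aT rT : finGroupType) (D : {group aT})
    (h : {morphism D >-> rT}) (x y : aT) :
  x \in D -> y \in D -> h (lcomm x y) = lcomm (h x) (h y).
Proof. by move=> Dx Dy; rewrite /lcomm !(morphM, morphV, groupM, groupV). Qed.

(** Once the image of [z] is central, [z] cancels from the right-hand sides of all relations with
    distinct indices, and the conjugates of [z] in the diagonal ones become [z]. The boolean selects
    the kind of pair: [r1] against [t2], or [t1] against [r2]. A general morphism serves both G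
    itself and its quotients. *)
Lemma diagonal_dks_pairing (gT rT : finGroupType) (G D : {group gT})
    (h : {morphism D >-> rT}) (b n : nat) (r1 t1 r2 t2 : 'I_b -> gT) (z : gT) :
    diagonal_dks G n r1 t1 r2 t2 z -> G \subset D ->
    h z \in 'C(h @* G) ->
  central_pairing (h @* G)%G
    (fun i : bool * 'I_b => h ((if i.1 then r1 else t1) i.2))
    (fun i : bool * 'I_b => h ((if i.1 then t2 else r2) i.2)) (h z).
Proof.
move=> dksG sGD /centP chz.
have [[[[Gr1 Gt1] Gr2] Gt2] Gz] : (((forall j, r1 j \in G) *
    (forall j, t1 j \in G)) * (forall j, r2 j \in G) *
    (forall j, t2 j \in G)) * (z \in G).
  rewrite -(dks_gen dksG); split; [split; [split; [split|]|]|];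
    move=> *; by rewrite mem_gen // !in_setU ?imset_f ?set11 ?orbT.
have cz g : g \in G -> commute (h z) (h g).
  by move=> Gg; apply: chz; rewrite mem_morphim // (subsetP sGD).
have Dz := subsetP sGD _ Gz.
have Dr1 j := subsetP sGD _ (Gr1 j); have Dr2 j := subsetP sGD _ (Gr2 j).
have Dt1 j := subsetP sGD _ (Gt1 j); have Dt2 j := subsetP sGD _ (Gt2 j).
have lcz g : g \in G -> lcomm (h g) (h z) = 1.
  by move=> Gg; rewrite /lcomm -(cz g Gg) mulgK mulgV.
have lzc g : g \in G -> lcomm (h z^-1) (h g) = 1.
  by move=> Gg; rewrite /lcomm morphV // invgK -(mulgA _ (h g)) -cz // mulKg mulgV.
have czM g k : g \in G -> h z * (h g * k) = h g * (h z * k).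
  by move=> Gg; rewrite !mulgA cz.
have czMV g k : g \in G -> h z * ((h g)^-1 * k) = (h g)^-1 * (h z * k).
  by move=> Gg; rewrite -morphV ?(subsetP sGD) // czM ?groupV.
have r1r2 i j : lcomm (h (r1 i)) (h (r2 j)) = 1.
  rewrite -lcomm_morph //; case: (ltngtP i j) => [ij|ji|/val_inj->].
  - by rewrite (dks_r1r2_lt dksG) // morph1.
  - rewrite (dks_r1r2_gt dksG) // !(morphM, morphV, groupM, groupV) //.
    by rewrite -!mulgA -czMV // -czM // !mulKg mulgV.
  - by rewrite (dks_r1r2_eq dksG) morph1.
have t1t2 i j : lcomm (h (t1 i)) (h (t2 j)) = 1.
  rewrite -lcomm_morph //; case: (ltngtP i j) => [ij|ji|/val_inj->].
  - by rewrite (dks_t1t2_lt dksG) // morph1.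
  - rewrite (dks_t1t2_gt dksG) // !(morphM, morphV, groupM, groupV) //.
    by rewrite -!mulgA czM // mulKg mulKVg czMV // mulKVg mulKg mulgV.
  - rewrite (dks_t1t2_eq dksG) lcomm_morph ?groupV // lcz ?groupV //.
have r1t2 i j : i != j -> lcomm (h (r1 i)) (h (t2 j)) = 1.
  rewrite -lcomm_morph //; case: (ltngtP i j) => [ij|ji|/val_inj->] => [_|_|/eqP//].
  - by rewrite (dks_r1t2_lt dksG) // morph1.
  - by rewrite (dks_r1t2_gt dksG) // lcomm_morph ?groupV // lzc.
have t1r2 i j : i != j -> lcomm (h (t1 i)) (h (r2 j)) = 1.
  rewrite -lcomm_morph //; case: (ltngtP i j) => [ij|ji|/val_inj->] => [_|_|/eqP//].
  - by rewrite (dks_t1r2_lt dksG) // morph1.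
  - by rewrite (dks_t1r2_gt dksG) // lcomm_morph ?groupV // lcz ?groupV.
have hG : h z \in h @* G by rewrite mem_morphim.
split.
- apply/eqP; rewrite eqEsubset gen_subG; apply/andP; split.
    apply/subsetP=> _ /setUP[/setUP[]/imsetP[[[] i] _ ->]|/set1P->] //=;
      by rewrite mem_morphim.
  rewrite /= -{1}(dks_gen dksG) morphim_gen; last first.
    by rewrite (subset_trans _ sGD) // -(dks_gen dksG) subset_gen.
  rewrite gen_subG; apply/subsetP=> _ /morphimP[y _ Xy ->]; apply: mem_gen.
  rewrite 2!in_setU; move: Xy; rewrite !in_setU -!orbA.
  case/or4P=> [/imsetP[j _ ->]|/imsetP[j _ ->]|/imsetP[j _ ->]|].
  + by apply/or3P/Or31/imsetP; exists (true, j).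
  + by apply/or3P/Or31/imsetP; exists (false, j).
  + by apply/or3P/Or32/imsetP; exists (false, j).
  case/orP=> [/imsetP[j _ ->]|/set1P->]; last by rewrite set11 !orbT.
  by apply/or3P/Or32/imsetP; exists (true, j).
- by rewrite inE hG; apply/centP.
- move=> [[] i] [[] j] /= ij;
  by rewrite commg_lcomm ?r1r2 ?t1t2 ?r1t2 ?t1r2 ?conj1g //.
case=> [[] i] /=; rewrite commg_lcomm -lcomm_morph // -morphM //.
  rewrite (dks_r1t2_eq dksG) morphV // conjVg cycleV /conjg cz ?groupM //.
  by rewrite mulKg.
rewrite (dks_t1r2_eq dksG) !morphM ?groupM ?groupV // morphV //.
rewrite -mulgA -/(h z ^ h (t2 i)) -conjgM -!morphM ?groupM //.
by rewrite /conjg cz ?groupM // mulKg.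
Qed.

(** * Centrality of z *)

(** Since x ^ g = x [x, g], the class of [x] lies in the coset xK. *)
Lemma card_class_sub_commg (gT : finGroupType) (G K : {group gT}) (x : gT) :
  [~: [set x], G] \subset K -> #|x ^: G| <= #|K|.
Proof.
move=> sxGK; rewrite -(card_lcoset K x) subset_leq_card //.
apply/subsetP=> _ /imsetP[g Gg ->]; rewrite mem_lcoset -commgEl.
by rewrite (subsetP sxGK) // mem_commg ?set11.
Qed.

(** The bound |H| >= #[z]^(2b+1) excludes #[z] >= 3, as 3^5 = 243 > 64, and then b >= 3, as 2^7 =
    128 > 64. What remains has |H| <= 64 = 2 * 2^5, which is the case covered by
    [central_pairing_der1]. *)
Lemma small_central_pairing (gT : finGroupType) (H : {group gT}) (b : nat)
    (e f : bool * 'I_b -> gT) (z : gT) :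
    central_pairing H e f z -> 1 < b -> z != 1 -> #|H| <= 64 ->
  [/\ #[z] = 2, 32 <= #|H|, H^`(1) \subset <[z]> & 16 * #|'Z(H)| <= #|H|].
Proof.
move=> cpH b_gt1 ntz leH.
have He i : e i \in H by case: (central_pairing_mem i cpH).
have Hz : z \in H by have /setIP[] := cp_center cpH.
have leq_H := leq_card_central_pairing cpH He Hz.
have leq_Z := card_center_central_pairing cpH.
have derH := central_pairing_der1 cpH.
move: leq_H leq_Z derH; rewrite card_prod card_bool card_ord.
have oz_gt1 : 1 < #[z] by rewrite order_gt1.
have [oz|oz_gt2] := eqVneq #[z] 2; last first.
  move/leq_trans/(_ leH); have {oz_gt1}oz_gt2 : 2 < #[z].
    by rewrite ltn_neqAle eq_sym oz_gt2.
  have: 3 ^ 5 <= #[z] ^ (2 * b).+1.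
    apply: (@leq_trans (3 ^ (2 * b).+1)); last by rewrite leq_exp2r.
    by rewrite leq_exp2l // ltnS (leq_mul2l 2 2).
  by move/leq_trans=> le /le.
rewrite oz; have [->|b_neq2] := eqVneq b 2.
  by move=> le32 leZ derH; split=> //; apply: derH; apply: leq_trans leH _.
move/leq_trans/(_ leH); rewrite (leq_exp2l _ 6) // ltnS.
by case: b b_gt1 b_neq2 {e f cpH He} => [|[|[|b]]] //; rewrite !mulnS.
Qed.

(* Three subgroup lemma: C = C_G(z) satisfies [C, G] <= <z> Z(G) <= C_G(C),   *)
(* hence [C, C] <= Z(G).                                                      *)
Lemma der1_cent_ucn2 (gT : finGroupType) (G : {group gT}) (z : gT) :
    z \in G -> G^`(1) \subset <[z]> <*> 'Z(G) ->
  'C_G[z]^`(1) \subset 'Z(G).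
Proof.
move=> Gz sG'; rewrite subsetI (subset_trans (der_sub _ _)) ?subsetIl //.
set C := 'C_G[z]; have sCG : C \subset G by apply: subsetIl.
have cCM : <[z]> <*> 'Z(G) \subset 'C(C).
  rewrite join_subG cycle_subG; apply/andP; split.
    by apply/centP=> c /setIP[_ /cent1P].
  by rewrite (subset_trans (subsetIr _ _)) // centS.
have cGCC : [~: G, C, C] = 1.
  apply/commG1P; apply: subset_trans (subset_trans sG' cCM).
  exact: commgS.
apply/commG1P; apply: three_subgroup => //.
by rewrite [[~: C, G]]commGC.
Qed.

(** For q in Q outside A, an element of A commuting with q has a centralizer strictly above A, hence
    is central in Q. The index of these elements in A is the size of a class inside a coset of
    Q'. *)
Lemma abelian_index2_center (gT : finGroupType) (Q A : {group gT}) :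
    A \subset Q -> abelian A -> #|Q : A| <= 2 ->
  #|A| <= #|'Z(Q)| * #|Q^`(1)|.
Proof.
move=> sAQ abA iA; have [sQA|] := boolP (Q \subset A).
  have ->: 'Z(Q) = Q.
    by apply/center_idP; apply: abelianS abA.
  by rewrite (leq_trans (subset_leq_card sAQ)) // leq_pmulr.
case/subsetPn=> q Qq A'q.
have sZ : 'C_A[q] \subset 'Z(Q).
  apply/subsetP=> s /setIP[As cqs]; rewrite inE (subsetP sAQ) //=.
  suffices: Q \subset 'C[s] by rewrite sub_cent1.
  have sAC : A \subset 'C_Q[s].
    by rewrite subsetI sAQ sub_cent1 (subsetP abA).
  have ltAC : 1 < #|'C_Q[s] : A|.
    rewrite indexg_gt1; apply/subsetPn; exists q => //.
    by rewrite inE Qq cent1C.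
  have: #|Q : 'C_Q[s]| <= 1.
    rewrite -(@leq_pmul2r 2) // (leq_trans _ iA) //.
    by rewrite -(Lagrange_index _ sAC) ?subsetIl ?leq_mul2l ?ltAC ?orbT.
  by rewrite leqNgt indexg_gt1 negbK subsetI subxx.
rewrite -(Lagrange (subsetIl A 'C[q])) leq_mul ?subset_leq_card //=.
rewrite index_cent1 (leq_trans (subset_leq_card (imsetS _ sAQ))) //.
by rewrite card_class_sub_commg // commSg // sub1set.
Qed.

Lemma diagonal_dks_central (gT : finGroupType) (G : {group gT}) (b n : nat)
    (r1 t1 r2 t2 : 'I_b -> gT) (z : gT) :
  #|G| = 64 -> diagonal_dks G n r1 t1 r2 t2 z -> z \in 'Z(G).
Proof.
move=> oG dksG; have pG : 2.-group G by rewrite /pgroup oG.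
have Gz : z \in G by rewrite -(dks_gen dksG) mem_gen // !inE eqxx orbT.
have ntz : z != 1 by rewrite -order_gt1 (dks_order dksG) (dks_n_ge2 dksG).
have /ucnP[m Zm] := pgroup_nil pG.
have: exists m, z \in 'Z_m(G) by exists m; rewrite Zm.
(* Take the least upper central term containing [z]. It is not the 0th, as z <> 1, and the first is
   the claim; beyond that, N is the term just before, so [z] is nontrivial and central modulo N. *)
case/ex_minnP=> -[|i]; first by rewrite ucn0 inE (negPf ntz).
move=> zS zmin; have zi' : z \notin 'Z_i(G).
  by apply/negP=> /zmin; rewrite ltnn.
case: i => [|i] in zS zi' {zmin} *; first by rewrite -ucn1.
set N := 'Z_i.+1(G)%G in zS zi'; have nNG : G \subset 'N(N) := ucn_norm _ _.
have Zz : coset N z \in 'Z(G / N) by rewrite -ucn_central mem_quotient.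
have chz : coset N z \in 'C(coset N @* G).
  by have /setIP[] := Zz.
have cpQ := diagonal_dks_pairing dksG nNG chz.
have ntzN : coset N z != 1.
  by apply: contra zi' => /eqP/coset_idr; apply; rewrite (subsetP nNG).
have leQ : #|G / N| <= 64 by rewrite -oG leq_quotient.
have [oz oQ dQ oZQ] := small_central_pairing cpQ (dks_b_ge2 dksG) ntzN leQ.
have sNG : N \subset G := ucn_sub _ _.
(* The quotient has order at least 32, so N has order at most 2 and must coincide with the
   nontrivial centre. *)
have oN : #|N| <= 2.
  rewrite -(@leq_pmul2r 32) // (leq_trans _ (_ : 64 <= _)) // -oG -(Lagrange sNG).
  by rewrite leq_mul2l -card_quotient // oQ orbT.
have sZN : 'Z(G) \subset N by rewrite -ucn1 ucn_sub_geq.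
have defN : 'Z(G) = N.
  apply/eqP; rewrite eqEcard sZN (leq_trans oN) // cardG_gt1.
  rewrite center_nil_eq1 ?(pgroup_nil pG) // -cardG_gt1 oG //.
have iC : #|G : 'C_G[z]| <= 2.
  rewrite index_cent1 (leq_trans _ oN) // card_class_sub_commg //.
  by rewrite (subset_trans _ (ucn_comm _ _)) // commSg // sub1set.
have sG' : G^`(1) \subset <[z]> <*> 'Z(G).
  rewrite defN -(quotientSGK (subset_trans (der_sub _ _) nNG)) ?joing_subr //.
  rewrite quotient_der // (subset_trans dQ) // cycle_subG.
  by rewrite mem_quotient // (subsetP (joing_subl _ _)) ?cycle_id.
have := der1_cent_ucn2 Gz sG'; rewrite defN => sC'.
have sCG : 'C_G[z] \subset G := subsetIl _ _.
have abC : abelian ('C_G[z] / N) by apply: sub_der1_abelian.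
have iCQ : #|G / N : 'C_G[z] / N| <= 2.
  apply: leq_trans iC; apply: dvdn_leq => //.
  by rewrite index_quotient // (subset_trans (subsetIl _ _)).
(* With Q = G / N and A the image of the centralizer of [z]: 16 |Z(Q)| <= |Q| <= 2 |A| <= 4 |Z(Q)|,
   a contradiction. *)
have := abelian_index2_center (quotientS N sCG) abC iCQ.
move/leq_trans/(_ (leq_mul (leqnn _) (subset_leq_card dQ))).
rewrite -[#|<[_]>|]/#[_] oz => leA; have := cardG_gt0 'Z(G / N).
have: #|G / N| <= #|'Z(G / N)| * 2 * 2.
  by rewrite -(Lagrange (quotientS N sCG)) leq_mul.
move/(leq_trans oZQ); rewrite -mulnA mulnC leq_mul2l => /orP[/eqP->|] //.
Qed.

(** The identity morphism turns the structure into a central pairing on G; a single diagonal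
    commutator already generates [<[z]>], which makes G' all of it. *)
Lemma diagonal_dks_structure (gT : finGroupType) (G : {group gT}) :
    #|G| = 64 -> admits_diagonal_dks G ->
  exists z, [/\ #[z] = 2, z \in 'Z(G), G^`(1) = <[z]> & #|'Z(G)| <= 4].
Proof.
move=> oG [b [n [r1 [t1 [r2 [t2 [z dksG]]]]]]]; exists z.
have Zz := diagonal_dks_central oG dksG.
have b_gt1 := dks_b_ge2 dksG.
have ntz : z != 1 by rewrite -order_gt1 (dks_order dksG) (dks_n_ge2 dksG).
have chz : idm G z \in 'C(idm G @* G).
  by rewrite morphim_idm //; have /setIP[] := Zz.
have := diagonal_dks_pairing dksG (subxx G) chz.
have -> : (idm G @* G)%G = G by apply: val_inj; rewrite /= morphim_idm.
set e := fun _ => _; set f := fun _ => _; rewrite /= => cpG.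
have [oz _ dG oZ] : [/\ #[z] = 2, 32 <= #|G|, G^`(1) \subset <[z]>
   & 16 * #|'Z(G)| <= #|G|].
  by apply: small_central_pairing cpG _ _ _; rewrite // oG.
split=> //; last by rewrite -(@leq_pmul2l 16) // (leq_trans oZ) // oG.
apply/eqP; rewrite eqEsubset dG cycle_subG -cycle_subG.
pose i := (true, Ordinal (ltnW b_gt1)).
rewrite -(cp_diag cpG i) cycle_subG mem_commg //.
  by have [] := central_pairing_mem i cpG.
by have [] := central_pairing_mem i cpG.
Qed.

(** * Presentations *)

Lemma expg_pair (gT rT : finGroupType) (x : gT) (y : rT) n :
  (x, y) ^+ n = (x ^+ n, y ^+ n).
Proof. by elim: n => // n IHn; rewrite !expgS IHn. Qed.

(* The squares are words in z and w; the four generator presentations are the *)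
(* case w = u ^+ 2, that is e = 0 and f = 1.                                  *)
Record quad_rels (gT : finGroupType) (a b c d e f : nat)
    (z x y u v w : gT) : Prop := QuadRels {
  qr_xy : [~ x, y] = z; qr_uv : [~ u, v] = z;
  qr_xu : [~ x, u] = 1; qr_xv : [~ x, v] = 1;
  qr_yu : [~ y, u] = 1; qr_yv : [~ y, v] = 1;
  qr_xw : [~ x, w] = 1; qr_yw : [~ y, w] = 1;
  qr_uw : [~ u, w] = 1; qr_vw : [~ v, w] = 1;
  qr_xz : [~ x, z] = 1; qr_yz : [~ y, z] = 1;
  qr_z2 : z ^+ 2 = 1;
  qr_x2 : x ^+ 2 = z ^+ a; qr_y2 : y ^+ 2 = z ^+ b; qr_v2 : v ^+ 2 = z ^+ c;
  qr_w2 : w ^+ 2 = z ^+ d; qr_u2 : u ^+ 2 = z ^+ e * w ^+ f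
}.

Lemma quad_rels_pair (gT rT : finGroupType) a b c d e f
    (z x y u v w : gT) (z' x' y' u' v' w' : rT) :
    quad_rels a b c d e f z x y u v w ->
    quad_rels a b c d e f z' x' y' u' v' w' ->
  quad_rels a b c d e f (z, z') (x, x') (y, y') (u, u') (v, v') (w, w').
Proof.
case=> ? ? ? ? ? ? ? ? ? ? ? ? ? ? ? ? ? ?.
case=> ? ? ? ? ? ? ? ? ? ? ? ? ? ? ? ? ? ?.
by split; rewrite ?expg_pair; apply: injective_projections.
Qed.

Lemma card_joing_cycle_sqr (gT : finGroupType) (M : {group gT}) (g : gT) :
  g \in 'N(M) -> g ^+ 2 \in M -> #|M <*> <[g]>| <= 2 * #|M|.
Proof.
move=> nMg Mg2; have nMG : <[g]> \subset 'N(M) by rewrite cycle_subG.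
rewrite -(Lagrange (joing_subl M <[g]>)) mulnC leq_mul2r; apply/orP; right.
rewrite -card_quotient ?join_subG ?normG // quotientYidl // quotient_cycle //.
apply: dvdn_leq => //; rewrite order_dvdn -morphX //.
by apply/eqP/coset_id.
Qed.

Lemma norm_joing_cycle (gT : finGroupType) (M : {group gT}) (g h : gT) :
  g \in 'N(M) -> [~ h, g] \in M -> g \in 'N(M <*> <[h]>).
Proof.
move=> nMg Mhg; rewrite inE conjYg join_subG (normP nMg) joing_subl /=.
rewrite -cycleJ cycle_subG -[h ^ g](mulKVg h) -commgEl.
by rewrite groupM ?(subsetP (joing_subl M _) _ Mhg) // mem_gen // inE cycle_id orbT.
Qed.

Lemma norm_commg (gT : finGroupType) (g h : gT) :
  [~ g, h] = 1 -> g \in 'N(<[h]>).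
Proof.
by move/eqP/commgP=> cgh; rewrite (subsetP (cent_sub _)) // cent_cycle; apply/cent1P.
Qed.

(** Adjoin z, w, u, v, x, y in this order: each normalizes the subgroup generated so far and has its
    square in it, so the order at most doubles, six times in all. Here [w] precedes [u] because
    [u ^+ 2] is a word in [z] and [w]. *)
Lemma card_quad_rels (gT : finGroupType) a b c d e f (z x y u v w : gT) :
    quad_rels a b c d e f z x y u v w ->
  #|<[x]> <*> <[y]> <*> <[u]> <*> <[v]> <*> <[w]>| <= 64.
Proof.
case=> xy uv xu xv yu yv xw yw uw vw xz yz z2 x2 y2 v2 w2 u2.
(* As z = [x, y], whatever commutes with [x] and [y] commutes with [z]. *)
have comz g : [~ x, g] = 1 -> [~ y, g] = 1 -> [~ g, z] = 1.
  move=> /eqP/commgP cxg /eqP/commgP cyg; apply/eqP/commgP; rewrite -xy.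
  have [cgx cgy] := (commute_sym cxg, commute_sym cyg).
  rewrite /commg /conjg; apply: commuteM; first exact: commuteV.
  by apply: commuteM; [apply: commuteV | apply: commuteM].
have [uz vz wz] : [/\ [~ u, z] = 1, [~ v, z] = 1 & [~ w, z] = 1].
  by split; apply: comz.
have subl (M : {group gT}) g s : s \in M -> s \in M <*> <[g]>.
  by apply: subsetP; apply: joing_subl.
have subr (M : {group gT}) g : g \in M <*> <[g]>.
  by rewrite mem_gen // inE cycle_id orbT.
have comV (s t : gT) r : [~ s, t] = r -> [~ t, s] = r^-1.
  by rewrite -invg_comm => <-; rewrite invgK.
pose L0 := <[z]>%G; pose L1 := (L0 <*> <[w]>)%G; pose L2 := (L1 <*> <[u]>)%G.
pose L3 := (L2 <*> <[v]>)%G; pose L4 := (L3 <*> <[x]>)%G.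
pose L5 := (L4 <*> <[y]>)%G.
have z0 : z \in L0 by apply: cycle_id.
have [z1 w1] : z \in L1 /\ w \in L1 by split; [apply: subl|apply: subr].
have [z_2 w_2 u_2] : [/\ z \in L2, w \in L2 & u \in L2].
  by split; [apply: subl|apply: subl|apply: subr].
have [z_3 v_3] : z \in L3 /\ v \in L3 by split; [apply: subl|apply: subr].
have z_4 : z \in L4 by apply: subl.
have o0 : #|L0| <= 2 by rewrite dvdn_leq // order_dvdn z2.
have o1 : #|L1| <= 4.
  apply: leq_trans (card_joing_cycle_sqr (norm_commg wz) _) _; last first.
    by rewrite (leq_mul2l 2 _ 2).
  by rewrite w2 groupX.
have uN1 : u \in 'N(L1).
  by apply: norm_joing_cycle; rewrite ?norm_commg // (comV _ _ _ uw) invg1 group1.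
have o2 : #|L2| <= 8.
  apply: leq_trans (card_joing_cycle_sqr uN1 _) _; last first.
    by rewrite (leq_mul2l 2 _ 4).
  by rewrite u2 groupM ?groupX.
have vN2 : v \in 'N(L2).
  apply: norm_joing_cycle; last by rewrite uv.
  by apply: norm_joing_cycle; rewrite ?norm_commg // (comV _ _ _ vw) invg1 group1.
have o3 : #|L3| <= 16.
  apply: leq_trans (card_joing_cycle_sqr vN2 _) _; last first.
    by rewrite (leq_mul2l 2 _ 8).
  by rewrite v2 groupX.
have N3 g : [~ g, z] = 1 -> [~ g, w] = 1 -> [~ g, u] = 1 -> [~ g, v] = 1 ->
    g \in 'N(L3).
  move=> gz gw gu gv.
  apply: norm_joing_cycle; last by rewrite (comV _ _ _ gv) invg1 group1.
  apply: norm_joing_cycle; last by rewrite (comV _ _ _ gu) invg1 group1.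
  apply: norm_joing_cycle; last by rewrite (comV _ _ _ gw) invg1 group1.
  exact: norm_commg.
have o4 : #|L4| <= 32.
  apply: leq_trans (card_joing_cycle_sqr (N3 _ xz xw xu xv) _) _; last first.
    by rewrite (leq_mul2l 2 _ 16).
  by rewrite x2 groupX.
have yN4 : y \in 'N(L4) by rewrite norm_joing_cycle ?N3 // xy.
have o5 : #|L5| <= 64.
  apply: leq_trans (card_joing_cycle_sqr yN4 _) _; last first.
    by rewrite (leq_mul2l 2 _ 32).
  by rewrite y2 groupX.
apply: leq_trans o5; apply: subset_leq_card.
rewrite !join_subG !cycle_subG -!andbA.
have y5 : y \in L5 := subr _ _.
have x5 : x \in L5 := subl _ _ _ (subr _ _).
have v5 : v \in L5 := subl _ _ _ (subl _ _ _ v_3).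
have u5 : u \in L5 := subl _ _ _ (subl _ _ _ (subl _ _ _ u_2)).
have w5 : w \in L5 := subl _ _ _ (subl _ _ _ (subl _ _ _ w_2)).
by rewrite x5 y5 u5 v5 w5.
Qed.

(* The pairs of generators satisfy the same relations, so they generate a     *)
(* subgroup of G x H of order at most 64, which is the graph of a morphism.   *)
Lemma homg_quad_rels (gT rT : finGroupType) (G : {group gT}) (H : {group rT})
    a b c d e f (z x y u v w : gT) (z' x' y' u' v' w' : rT) :
    #|G| = 64 ->
    <[x]> <*> <[y]> <*> <[u]> <*> <[v]> <*> <[w]> = G ->
    <[x']> <*> <[y']> <*> <[u']> <*> <[v']> <*> <[w']> = H ->
    quad_rels a b c d e f z x y u v w ->
    quad_rels a b c d e f z' x' y' u' v' w' ->
  H \homg G.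
Proof.
move=> oG genG genH relG relH.
have := card_quad_rels (quad_rels_pair relG relH).
set K := _ <*> <[(w, w')]>; move=> leK.
have fstK : [morphism of @fst gT rT] @* K = G.
  by rewrite -genG !morphimY ?morphim_cycle ?inE ?subsetT.
have sndK : [morphism of @snd gT rT] @* K = H.
  by rewrite -genH !morphimY ?morphim_cycle ?inE ?subsetT.
have isoGK : G \isog K by rewrite isogEcard -{1}fstK morphim_homg ?subsetT // oG.
by rewrite -sndK (homg_trans (morphim_homg _ (subsetT K))) // isog_hom // isog_sym.
Qed.

(** * Recognition of the seven groups *)

Lemma joing_sqr (gT : finGroupType) (x y u v : gT) :
  <[x]> <*> <[y]> <*> <[u]> <*> <[v]> <*> <[u ^+ 2]>
    = <[x]> <*> <[y]> <*> <[u]> <*> <[v]>.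
Proof.
apply/joing_idPl; rewrite cycle_subG groupX //.
by rewrite mem_gen // inE mem_gen // inE cycle_id orbT.
Qed.

(** For involutions, [x, y] = (xy)^2, which equals its inverse (yx)^2; conjugation by [x] or by [y]
    exchanges xy and yx. *)
Lemma dihedral_commg (gT : finGroupType) (x y : gT) :
    x ^+ 2 = 1 -> y ^+ 2 = 1 -> (x * y) ^+ 4 = 1 ->
  [/\ [~ x, [~ x, y]] = 1, [~ y, [~ x, y]] = 1 & [~ x, y] ^+ 2 = 1].
Proof.
have invE (t : gT) : t ^+ 2 = 1 -> t^-1 = t.
  by move=> t2; apply/eqP; rewrite eq_invg_mul -[t * t]/(t ^+ 2) t2.
move=> x2 y2 xy4; have [xV yV] := (invE x x2, invE y y2).
have xyE : [~ x, y] = (x * y) ^+ 2 by rewrite commgEl /conjg xV yV expgS expg1 !mulgA.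
have z2 : [~ x, y] ^+ 2 = 1 by rewrite xyE -expgM.
have yxE : (y * x) ^+ 2 = [~ x, y].
  by rewrite -(invE _ z2) invg_comm commgEl /conjg xV yV expgS expg1 !mulgA.
have fixE t : (x * y) ^ t = y * x -> [~ t, [~ x, y]] = 1.
  move=> xyt; apply/eqP/commgP/commute_sym/commgP/conjg_fixP.
  by rewrite {1}xyE conjXg xyt.
split; rewrite // fixE // conjgE !mulgA ?mulVg ?mul1g //.
by rewrite -!mulgA -[y * y]/(y ^+ 2) y2 mulg1 yV.
Qed.

Lemma quad_rels_sqr (gT : finGroupType) (x y u v : gT) a b c d :
    [~ u, v] = [~ x, y] ->
    [~ x, u] = 1 -> [~ x, v] = 1 -> [~ y, u] = 1 -> [~ y, v] = 1 ->
    [~ x, [~ x, y]] = 1 -> [~ y, [~ x, y]] = 1 -> [~ x, y] ^+ 2 = 1 ->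
    x ^+ 2 = [~ x, y] ^+ a -> y ^+ 2 = [~ x, y] ^+ b ->
    v ^+ 2 = [~ x, y] ^+ c -> u ^+ 4 = [~ x, y] ^+ d ->
  quad_rels a b c d 0 1 [~ x, y] x y u v (u ^+ 2).
Proof.
move=> uv xu xv yu yv xz yz z2 x2 y2 v2 u4.
have comX s : [~ s, u] = 1 -> [~ s, u ^+ 2] = 1.
  by move=> /eqP/commgP csu; apply/eqP/commgP/commuteX.
have cxu : commute u x by apply/commute_sym/commgP/eqP.
have cyu : commute u y by apply/commute_sym/commgP/eqP.
have cuz : commute u [~ x, y].
  rewrite /commg /conjg; apply: commuteM; first exact: commuteV.
  by apply: commuteM; [apply: commuteV | apply: commuteM].
have vw : [~ v, u ^+ 2] = 1.
  by rewrite -invg_comm commXg uv ?z2 ?invg1.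
by split; rewrite ?vw ?comX ?commgg // -?expgM // ?mul1g ?expg1.
Qed.

(** In class two, (xy)^4 = x^4 y^4 [y, x]^6, and every factor is an even power of [z]. *)
Lemma quad_rels_xy4 (gT : finGroupType) a b c d e f (z x y u v w : gT) :
  quad_rels a b c d e f z x y u v w -> (x * y) ^+ 4 = 1.
Proof.
case=> xy _ _ _ _ _ _ _ _ _ /eqP/commgP cxz /eqP/commgP cyz z2 x2 y2 _ _ _.
have z2k k : z ^+ k ^+ 2 = 1 by rewrite -expgM mulnC expgM z2 expg1n.
have yx : [~ y, x] = z^-1 by rewrite -invg_comm xy.
rewrite expMg_Rmul ?yx; [|exact: commuteV..].
rewrite (expgM x 2 2) (expgM y 2 2) x2 y2 !z2k !mul1g.
by rewrite (_ : 'C(4, 2) = 2 * 3)%N // expgM expVgn z2 invg1 expg1n.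
Qed.

(* Proves the equality of tuples to which G \homg Grp (...) unfolds; rewriting *)
(* inside that equality makes its kernel check very slow.                      *)
Local Notation "p &, q" := (congr2 pair p q) (at level 60, right associativity).

(** Here and in the six analogues, G satisfies the presentation, and any group H satisfying it also
    satisfies the [quad_rels] with the same exponents, so it is an image of G by
    [homg_quad_rels]. *)
Lemma isog_G64_199 (gT : finGroupType) (G : {group gT}) (z x y u v : gT) :
    #|G| = 64 -> <[x]> <*> <[y]> <*> <[u]> <*> <[v]> = G ->
  quad_rels 0 0 0 0 0 1 z x y u v (u ^+ 2) -> isog_G64 G 199.
Proof.
move=> oG genG rG; constructor; apply: intro_isoGrp.
  case: (rG) => xy uv xu xv yu yv _ _ _ _ _ _ z2 x2 y2 v2 w2 _.
  have u4 : u ^+ 4 = 1 by rewrite (expgM u 2 2).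
  have xy4 := quad_rels_xy4 rG; rewrite -xy in uv.
  apply/existsP; exists (x, y, u, v); apply/eqP.
  exact: (genG &, x2 &, y2 &, xy4 &, u4 &, v2 &, uv &, xu &, xv &, yu &, yv).
move=> rT H /existsP[[[[x' y'] u'] v'] /eqP[genH x2 y2 xy4 u4 v2 uv xu xv yu yv]].
have [xz yz z2] := dihedral_commg x2 y2 xy4.
rewrite -joing_sqr in genG; rewrite -joing_sqr in genH.
by apply: homg_quad_rels oG genG genH rG _; apply: quad_rels_sqr.
Qed.

Lemma isog_G64_201 (gT : finGroupType) (G : {group gT}) (z x y u v : gT) :
    #|G| = 64 -> <[x]> <*> <[y]> <*> <[u]> <*> <[v]> = G ->
  quad_rels 0 0 1 0 0 1 z x y u v (u ^+ 2) -> isog_G64 G 201.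
Proof.
move=> oG genG rG; constructor; apply: intro_isoGrp.
  case: (rG) => xy uv xu xv yu yv _ _ _ _ _ _ z2 x2 y2 v2 w2 _.
  have u4 : u ^+ 4 = 1 by rewrite (expgM u 2 2).
  have xy4 := quad_rels_xy4 rG; rewrite -xy in uv v2.
  apply/existsP; exists (x, y, u, v); apply/eqP.
  exact: (genG &, x2 &, y2 &, xy4 &, u4 &, v2 &, uv &, xu &, xv &, yu &, yv).
move=> rT H /existsP[[[[x' y'] u'] v'] /eqP[genH x2 y2 xy4 u4 v2 uv xu xv yu yv]].
have [xz yz z2] := dihedral_commg x2 y2 xy4.
rewrite -joing_sqr in genG; rewrite -joing_sqr in genH.
by apply: homg_quad_rels oG genG genH rG _; apply: quad_rels_sqr.
Qed.

Lemma quaternion_commg (gT : finGroupType) (x y : gT) :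
    x ^+ 4 = 1 -> y ^+ 2 = x ^+ 2 -> [~ x, y] = x ^+ 2 ->
  [/\ [~ x, [~ x, y]] = 1, [~ y, [~ x, y]] = 1 & [~ x, y] ^+ 2 = 1].
Proof.
move=> x4 y2 xy; rewrite xy -expgM x4; split=> //.
  by apply/eqP/commgP/commuteX.
by rewrite -y2; apply/eqP/commgP/commuteX.
Qed.

Lemma isog_G64_200 (gT : finGroupType) (G : {group gT}) (z x y u v : gT) :
    #|G| = 64 -> <[x]> <*> <[y]> <*> <[u]> <*> <[v]> = G ->
  quad_rels 1 1 0 0 0 1 z x y u v (u ^+ 2) -> isog_G64 G 200.
Proof.
move=> oG genG rG; constructor; apply: intro_isoGrp.
  case: (rG) => xy uv xu xv yu yv _ _ _ _ _ _ z2 x2 y2 v2 w2 _.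
  have u4 : u ^+ 4 = 1 by rewrite (expgM u 2 2).
  have x4 : x ^+ 4 = 1 by rewrite (expgM x 2 2) x2.
  rewrite -xy in uv; rewrite -x2 in y2; rewrite expg1 -xy in x2.
  have {}xy := esym x2.
  apply/existsP; exists (x, y, u, v); apply/eqP.
  exact: (genG &, x4 &, y2 &, xy &, u4 &, v2 &, uv &, xu &, xv &, yu &, yv).
move=> rT H /existsP[[[[x' y'] u'] v'] /eqP[genH x4 y2 xy u4 v2 uv xu xv yu yv]].
have [xz yz z2] := quaternion_commg x4 y2 xy.
rewrite -joing_sqr in genG; rewrite -joing_sqr in genH.
by apply: homg_quad_rels oG genG genH rG _; apply: quad_rels_sqr; rewrite ?y2.
Qed.

Lemma isog_G64_249 (gT : finGroupType) (G : {group gT}) (z x y u v : gT) :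
    #|G| = 64 -> <[x]> <*> <[y]> <*> <[u]> <*> <[v]> = G ->
  quad_rels 1 1 0 1 0 1 z x y u v (u ^+ 2) -> isog_G64 G 249.
Proof.
move=> oG genG rG; constructor; apply: intro_isoGrp.
  case: (rG) => xy uv xu xv yu yv _ _ _ _ _ _ z2 x2 y2 v2 w2 _.
  have u4 : u ^+ 4 = [~ x, y] by rewrite (expgM u 2 2) w2 xy.
  have u8 : u ^+ 8 = 1 by rewrite (expgM u 4 2) u4 xy.
  have x4 : x ^+ 4 = 1 by rewrite (expgM x 2 2) x2.
  rewrite -xy in uv; rewrite -x2 in y2; rewrite expg1 -xy in x2.
  have {}xy := esym x2.
  apply/existsP; exists (x, y, u, v); apply/eqP.
  exact: (genG &, x4 &, y2 &, xy &, u8 &, u4 &, v2 &, uv &, xu &, xv &, yu &, yv).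
move=> rT H /existsP[[[[x' y'] u'] v'] /eqP[genH x4 y2 xy u8 u4 v2 uv xu xv yu yv]].
have [xz yz z2] := quaternion_commg x4 y2 xy.
rewrite -joing_sqr in genG; rewrite -joing_sqr in genH.
by apply: homg_quad_rels oG genG genH rG _; apply: quad_rels_sqr; rewrite ?y2.
Qed.

Lemma isog_G64_264 (gT : finGroupType) (G : {group gT}) (z x y u v w : gT) :
    #|G| = 64 -> <[x]> <*> <[y]> <*> <[u]> <*> <[v]> <*> <[w]> = G ->
  quad_rels 0 0 0 0 0 0 z x y u v w -> isog_G64 G 264.
Proof.
move=> oG genG rG; constructor; apply: intro_isoGrp.
  case: (rG) => xy uv xu xv yu yv xw yw uw vw _ _ z2 x2 y2 v2 w2 u2.
  have xy4 := quad_rels_xy4 rG; rewrite mulg1 in u2; rewrite -xy in uv.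
  apply/existsP; exists (x, y, u, v, w); apply/eqP.
  exact: (genG &, x2 &, y2 &, xy4 &, u2 &, v2 &, uv &, xu &, xv &, yu &, yv
            &, w2 &, xw &, yw &, uw &, vw).
move=> rT H /existsP[[[[[x' y'] u'] v'] w'] /eqP[genH]].
move=> x2 y2 xy4 u2 v2 uv xu xv yu yv w2 xw yw uw vw.
have [xz yz z2] := dihedral_commg x2 y2 xy4.
by apply: homg_quad_rels oG genG genH rG _; split; rewrite ?mulg1.
Qed.

Lemma isog_G64_265 (gT : finGroupType) (G : {group gT}) (z x y u v w : gT) :
    #|G| = 64 -> <[x]> <*> <[y]> <*> <[u]> <*> <[v]> <*> <[w]> = G ->
  quad_rels 0 0 1 0 1 0 z x y u v w -> isog_G64 G 265.
Proof.
move=> oG genG rG; constructor; apply: intro_isoGrp.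
  case: (rG) => xy uv xu xv yu yv xw yw uw vw _ _ z2 x2 y2 v2 w2 u2.
  have xy4 := quad_rels_xy4 rG; rewrite mulg1 in u2; rewrite -xy in uv u2 v2.
  apply/existsP; exists (x, y, u, v, w); apply/eqP.
  exact: (genG &, x2 &, y2 &, xy4 &, u2 &, v2 &, uv &, xu &, xv &, yu &, yv
            &, w2 &, xw &, yw &, uw &, vw).
move=> rT H /existsP[[[[[x' y'] u'] v'] w'] /eqP[genH]].
move=> x2 y2 xy4 u2 v2 uv xu xv yu yv w2 xw yw uw vw.
have [xz yz z2] := dihedral_commg x2 y2 xy4.
by apply: homg_quad_rels oG genG genH rG _; split; rewrite ?mulg1.
Qed.

Lemma isog_G64_266 (gT : finGroupType) (G : {group gT}) (z x y u v w : gT) :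
    #|G| = 64 -> <[x]> <*> <[y]> <*> <[u]> <*> <[v]> <*> <[w]> = G ->
  quad_rels 0 0 0 1 0 0 z x y u v w -> isog_G64 G 266.
Proof.
move=> oG genG rG; constructor; apply: intro_isoGrp.
  case: (rG) => xy uv xu xv yu yv xw yw uw vw _ _ z2 x2 y2 v2 w2 u2.
  have xy4 := quad_rels_xy4 rG; rewrite mulg1 in u2; rewrite -xy in uv w2.
  apply/existsP; exists (x, y, u, v, w); apply/eqP.
  exact: (genG &, x2 &, y2 &, xy4 &, u2 &, v2 &, uv &, xu &, xv &, yu &, yv
            &, w2 &, xw &, yw &, uw &, vw).
move=> rT H /existsP[[[[[x' y'] u'] v'] w'] /eqP[genH]].
move=> x2 y2 xy4 u2 v2 uv xu xv yu yv w2 xw yw uw vw.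
have [xz yz z2] := dihedral_commg x2 y2 xy4.
by apply: homg_quad_rels oG genG genH rG _; split; rewrite ?mulg1.
Qed.

(** * Symplectic quadruples and the square map *)

Section Classification.

Variables (gT : finGroupType) (G : {group gT}) (z : gT).
Hypotheses (oG : #|G| = 64) (oz : #[z] = 2) (Zz : z \in 'Z(G)).
Hypotheses (dG : G^`(1) = <[z]>) (oZ : #|'Z(G)| <= 4).

Let Gz : z \in G. Proof. by case/setIP: Zz. Qed.

Let z2 : z ^+ 2 = 1. Proof. by rewrite -oz expg_order. Qed.

Let zz : z * z = 1. Proof. exact: z2. Qed.

Let zV : z^-1 = z. Proof. by apply/eqP; rewrite eq_invg_mul zz. Qed.

Let ntz : z != 1. Proof. by rewrite -order_gt1 oz. Qed.

Let mem_z a : (a \in <[z]>) = (a == 1) || (a == z).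
Proof. by rewrite cycle2g // !inE. Qed.

Let comm_z a : a \in G -> commute a z.
Proof. by move=> Ga; have /setIP[_ /centP cz] := Zz; apply/commute_sym/cz. Qed.

Let comm_Z a c : a \in G -> c \in 'Z(G) -> [~ a, c] = 1.
Proof.
by move=> Ga /setIP[_ /centP cc]; apply/eqP/commgP/commute_sym/cc.
Qed.

Lemma commg_der2 a b : a \in G -> b \in G -> [~ a, b] = 1 \/ [~ a, b] = z.
Proof.
move=> Ga Gb; have: [~ a, b] \in <[z]> by rewrite -dG mem_commg.
by rewrite mem_z => /orP[]/eqP; [left | right].
Qed.

Lemma commg_z a b c : a \in G -> b \in G -> c \in G -> [~ a, b] ^ c = [~ a, b].
Proof.
move=> Ga Gb Gc; apply/conjg_fixP/commgP/commute_sym.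
by case: (commg_der2 Ga Gb) => ->; [apply: commute1 | apply: comm_z].
Qed.

Lemma commgC_der2 a b : a \in G -> b \in G -> [~ b, a] = [~ a, b].
Proof.
move=> Ga Gb; rewrite -invg_comm.
by case: (commg_der2 Ga Gb) => ->; rewrite ?invg1.
Qed.

Lemma commMg_der2 a b c :
  a \in G -> b \in G -> c \in G -> [~ a * b, c] = [~ a, c] * [~ b, c].
Proof. by move=> Ga Gb Gc; rewrite commMgJ commg_z. Qed.

Lemma commgM_der2 a b c :
  a \in G -> b \in G -> c \in G -> [~ a, b * c] = [~ a, c] * [~ a, b].
Proof. by move=> Ga Gb Gc; rewrite commgMJ commg_z. Qed.

(** Squaring is a quadratic map whose polar form is the commutator. *)
Lemma sqrM_der2 a b :
  a \in G -> b \in G -> (a * b) ^+ 2 = a ^+ 2 * b ^+ 2 * [~ a, b].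
Proof.
move=> Ga Gb; have cab c : c \in G -> commute c [~ b, a].
  move=> Gc; apply/commute_sym/commgP/conjg_fixP; exact: commg_z.
rewrite expMg_Rmul; [by rewrite commgC_der2 | exact: cab..].
Qed.

Lemma sqr_center a : a \in G -> a ^+ 2 \in 'Z(G).
Proof.
move=> Ga; rewrite inE groupX //; apply/centP=> b Gb.
apply/commgP; rewrite expgS expg1 commMg_der2 //.
by case: (commg_der2 Ga Gb) => ->; rewrite ?mulg1 ?zz.
Qed.

(** An element outside [<[z]>] forces the centre to have order 4, so that [<[z]>] has index two in
    it. *)
Lemma mul_center_coset a b : a \in 'Z(G) -> b \in 'Z(G) ->
  a \notin <[z]> -> b \notin <[z]> -> a * b \in <[z]>.
Proof.
move=> Za Zb z'a z'b; have szZ : <[z]> \subset 'Z(G) by rewrite cycle_subG.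
have iZ : #|'Z(G) : <[z]>| = 2.
  apply/eqP; rewrite eqn_leq indexg_gt1 -(@leq_pmul2l #|<[z]>|) //.
  rewrite (Lagrange szZ) -[#|<[z]>|]/#[z] oz oZ /=.
  by apply: contra z'a => /subsetP->.
have Zb' : b^-1 \in 'Z(G) :\: <[z]> by rewrite inE !groupV z'b.
have: a \in 'Z(G) :\: <[z]> by rewrite inE z'a.
by rewrite -(rcoset_index2 szZ iZ Zb') mem_rcoset invgK.
Qed.

(** Lifts to G of two orthogonal hyperbolic pairs for the commutator form. *)
Record symplectic_quad (x y u v : gT) : Prop := SymplecticQuad {
  sq_x : x \in G; sq_y : y \in G; sq_u : u \in G; sq_v : v \in G;
  sq_xy : [~ x, y] = z; sq_uv : [~ u, v] = z;
  sq_xu : [~ x, u] = 1; sq_xv : [~ x, v] = 1;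
  sq_yu : [~ y, u] = 1; sq_yv : [~ y, v] = 1
}.

Lemma symplectic_quad_swap x y u v :
  symplectic_quad x y u v -> symplectic_quad u v x y.
Proof. by case=> *; split=> //; rewrite commgC_der2. Qed.

Lemma symplectic_quad_flip x y u v :
  symplectic_quad x y u v -> symplectic_quad y x u v.
Proof. by case=> *; split=> //; rewrite commgC_der2. Qed.

Lemma symplectic_quad_mul x y u v :
  symplectic_quad x y u v -> symplectic_quad (x * y) y u v.
Proof.
case=> ? ? ? ? xy uv xu xv yu yv; split; rewrite ?groupM //.
- by rewrite commMg_der2 // xy commgg mulg1.
- by rewrite commMg_der2 // xu yu mulg1.
by rewrite commMg_der2 // xv yv mulg1.
Qed.

(** The change of basis that mixes the two planes: [v] is multiplied by [y] so that [xu, vy] =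
    [x, y] [u, v] = z^2 = 1. *)
Lemma symplectic_quad_transvection x y u v :
  symplectic_quad x y u v -> symplectic_quad (x * u) y u (v * y).
Proof.
case=> Gx Gy Gu Gv xy uv xu xv yu yv; split; rewrite ?groupM //.
- by rewrite commMg_der2 // xy (commgC_der2 Gy Gu) yu mulg1.
- by rewrite commgM_der2 // uv (commgC_der2 Gy Gu) yu mul1g.
- by rewrite commMg_der2 // xu commgg mulg1.
- rewrite commMg_der2 ?groupM // !commgM_der2 // xy xv uv (commgC_der2 Gy Gu) yu.
  by rewrite mulg1 mul1g zz.
by rewrite commgM_der2 // commgg yv mulg1.
Qed.

Lemma symplectic_quad_center c x y u v :
  c \in 'Z(G) -> symplectic_quad x y u v -> symplectic_quad (x * c) y u v.
Proof.
move=> Zc; have /setIP[Gc _] := Zc.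
case=> Gx Gy Gu Gv xy uv xu xv yu yv; split; rewrite ?groupM //.
- by rewrite commMg_der2 // xy (commgC_der2 Gy) // comm_Z // mulg1.
- by rewrite commMg_der2 // xu (commgC_der2 Gu) // comm_Z // mulg1.
by rewrite commMg_der2 // xv (commgC_der2 Gv) // comm_Z // mulg1.
Qed.

(** * Orthogonal complements and the centre *)

Lemma leq_cent1 (A : {group gT}) a :
  A \subset G -> a \in G -> #|A| <= 2 * #|'C_A[a]|.
Proof.
move=> sAG Ga; rewrite -(Lagrange (subsetIl A 'C[a])) mulnC leq_mul2r.
apply/orP; right; rewrite index_cent1 -oz.
apply: (@card_class_sub_commg _ A <[z]>%G).
by rewrite /= -dG commgSS // sub1set.
Qed.

(** Orthogonal projection: [w], one of 1, u, v, uv, cancels the component of [g] along the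
    hyperbolic plane. *)
Lemma hyperbolic_correct u v g :
    u \in G -> v \in G -> g \in G -> [~ u, v] = z ->
  exists w, [/\ w \in <[u]> <*> <[v]>, w \in G, [~ g * w, u] = 1
                & [~ g * w, v] = 1].
Proof.
move=> Gu Gv Gg uv; have vu : [~ v, u] = z by rewrite commgC_der2.
have Ju : u \in <[u]> <*> <[v]> by rewrite mem_gen // inE cycle_id.
have Jv : v \in <[u]> <*> <[v]> by rewrite mem_gen // inE cycle_id orbT.
case: (commg_der2 Gg Gu) => gu; case: (commg_der2 Gg Gv) => gv.
- by exists 1; rewrite !group1 mulg1.
- by exists u; rewrite !commMg_der2 // gu gv uv commgg zz mulg1.
- by exists v; rewrite !commMg_der2 // gu gv vu commgg zz mulg1.
exists (u * v); rewrite !commMg_der2 ?groupM // gu gv vu uv !commgg.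
by rewrite mulg1 mul1g zz.
Qed.

Lemma commg_joing_cycle (u v w s : gT) :
  [~ u, s] = 1 -> [~ v, s] = 1 -> w \in <[u]> <*> <[v]> -> [~ w, s] = 1.
Proof.
move=> us vs; suffices /subsetP sJC: <[u]> <*> <[v]> \subset 'C[s].
  by move/sJC/cent1P/commgP/eqP.
by rewrite join_subG !cycle_subG; apply/andP; split; apply/cent1P/commgP/eqP.
Qed.

(** The common centralizer of [u] and [v] has order at least 64 / 4 = 16. Together with [u] and [v]
    it generates G, so if it were abelian it would be central, of order at most 4. Two noncommuting
    elements of it have commutator [z]. *)
Lemma symplectic_quad_complete u v :
    u \in G -> v \in G -> [~ u, v] = z ->
  exists x y, symplectic_quad x y u v.
Proof.
move=> Gu Gv uv; pose C := 'C_('C_G[u])[v]%G.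
have sCuG : 'C_G[u] \subset G := subsetIl _ _.
have inC s : (s \in C) = [&& s \in G, s \in 'C[u] & s \in 'C[v]].
  by rewrite !in_setI andbA.
have oC : 16 <= #|C|.
  have: #|G| <= 2 * (2 * #|C|).
    by rewrite (leq_trans (leq_cent1 (subxx G) Gu)) // leq_mul2l leq_cent1.
  by rewrite oG mulnA (leq_pmul2l (m := 4) (n1 := 16)).
have: ~~ abelian C.
  apply: contraL oC => abC; rewrite -ltnNge (@leq_ltn_trans 4) //.
  apply: leq_trans oZ; apply/subset_leq_card/subsetP=> s Cs.
  have := Cs; rewrite inC => /and3P[Gs /cent1P su /cent1P sv].
  rewrite inE Gs; apply/centP=> g Gg; apply/commute_sym/commgP/eqP.
  have [w [Jw Gw gwu gwv]] := hyperbolic_correct Gu Gv Gg uv.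
  have: [~ g * w, s] = 1.
    apply/eqP/commgP; apply: (centsP abC) => //.
    by rewrite inC groupM //=; apply/andP; split; apply/cent1P/commgP/eqP.
  by rewrite commMg_der2 // (commg_joing_cycle _ _ Jw) ?mulg1 //;
    apply/eqP/commgP/commute_sym.
case/subsetPn=> x Cx; rewrite -sub_cent1 => /subsetPn[y Cy].
have [] := (Cx, Cy); rewrite !inC.
move=> /and3P[Gx /cent1P xu /cent1P xv] /and3P[Gy /cent1P yu /cent1P yv] cxy.
exists x, y; split=> //; try by apply/eqP/commgP.
have [xy|//] := commg_der2 Gx Gy.
by case/negP: cxy; apply/cent1P/commute_sym/commgP/eqP.
Qed.

(* A symplectic quadruple is a central pairing with itself, whence the bound  *)
(* on its centralizer.                                                        *)
Lemma card_cent_symplectic_quad x y u v :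
  symplectic_quad x y u v -> #|'C_G([set x; y; u; v])| <= 4.
Proof.
case=> Gx Gy Gu Gv xy uv xu xv yu yv.
pose e i := if i.1 then (if i.2 then x else y) else (if i.2 then u else v).
(* [f] sends each index to the hyperbolic partner of its element, so that only the diagonal
   commutators are nontrivial. *)
pose f (i : bool * bool) := e (i.1, ~~ i.2).
pose H := <<[set e i | i : bool * bool] :|: [set f i | i : bool * bool]
             :|: [set z]>>%G.
have Ge i : e i \in G by case: i => [[] []].
have cpH : central_pairing H e f z.
  have sHG : H \subset G.
    rewrite gen_subG; apply/subsetP=> _ /setUP[/setUP[]/imsetP[i _ ->]|/set1P->] //.
    exact: Ge.
  split=> //.
  - rewrite inE mem_gen /=; last by rewrite inE set11 orbT.
    by have /setIP[_] := Zz; apply/subsetP/centS.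
  - move=> [[] []] [[] []] // _; rewrite /e /f /= ?commgg //;
      by rewrite commgC_der2.
  by move=> [[] []]; rewrite /e /f /= ?xy ?uv // commgC_der2 ?xy ?uv.
have := card_central_pairing cpH Ge.
rewrite oz card_prod card_bool oG (leq_pmul2l (m := 16) (n2 := 4)) //.
apply: leq_trans; rewrite subset_leq_card // setIS // centS //.
apply/subsetP=> _ /imsetP[i _ ->]; rewrite !inE.
by case: i => [[] []]; rewrite /f /e /= eqxx ?orbT.
Qed.

(** The second correction lies in <u, v>, which centralizes [x] and [y], so it leaves the first one
    intact. *)
Lemma symplectic_quad_correct x y u v g :
    symplectic_quad x y u v -> g \in G ->
  exists w, [/\ w \in <[x]> <*> <[y]> <*> <[u]> <*> <[v]>, w \in G
    & g * w \in 'C_G([set x; y; u; v])].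
Proof.
case=> Gx Gy Gu Gv xy uv xu xv yu yv Gg.
have [w1 [J1 G1 gx gy]] := hyperbolic_correct Gx Gy Gg xy.
have [w2 [J2 G2 gu gv]] := hyperbolic_correct Gu Gv (groupM Gg G1) uv.
have [ux uy] : [~ u, x] = 1 /\ [~ u, y] = 1 by rewrite !(commgC_der2 _ Gu).
have [vx vy] : [~ v, x] = 1 /\ [~ v, y] = 1 by rewrite !(commgC_der2 _ Gv).
exists (w1 * w2); split; [|by rewrite groupM|].
  rewrite -joingA groupM //.
    exact: (subsetP (joing_subl _ _) _ J1).
  exact: (subsetP (joing_subr _ _) _ J2).
apply/setIP; split; first by rewrite !groupM.
apply/centP=> a; rewrite !inE -!orbA.
have com b : b \in G -> [~ g * w1 * w2, b] = 1 -> commute (g * (w1 * w2)) b.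
  by rewrite -mulgA => _ /eqP/commgP.
have [G12 w2x w2y] : [/\ g * w1 \in G, [~ w2, x] = 1 & [~ w2, y] = 1].
  by rewrite groupM // (commg_joing_cycle ux vx J2) (commg_joing_cycle uy vy J2).
case/or4P=> /eqP->; apply: com => //.
  by rewrite commMg_der2 // gx w2x mulg1.
by rewrite commMg_der2 // gy w2y mulg1.
Qed.

(** The centralizer D is a 2-group of order at most 4, hence abelian. Every element of G is one of D
    times a word in the quadruple, and D commutes with both factors. *)
Lemma cent_symplectic_quad x y u v :
  symplectic_quad x y u v -> 'C_G([set x; y; u; v]) = 'Z(G).
Proof.
move=> qG; have [Gx Gy Gu Gv _ _ _ _ _ _] := qG.
set D := 'C_G(_); have sZD : 'Z(G) \subset D.
  apply/setIS/centS/subsetP=> a.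
  by rewrite !inE -!orbA => /or4P[]/eqP->.
apply/eqP; rewrite eqEsubset sZD andbT.
have abD : abelian D.
  have sDG : D \subset G := subsetIl _ _.
  have pD : 2.-group D by rewrite (pgroupS sDG) // /pgroup oG.
  rewrite (p2group_abelian pD) // -(leq_exp2l (m := 2)) // -card_pgroup //.
  exact: card_cent_symplectic_quad qG.
apply/subsetP=> s Ds; have /setIP[Gs /centP cs] := Ds.
rewrite inE Gs; apply/centP=> g Gg.
have [w [Jw Gw Dgw]] := symplectic_quad_correct qG Gg.
have csw : commute s w.
  apply/cent1P; rewrite cent1C; apply: subsetP Jw; rewrite !join_subG !cycle_subG.
  by rewrite -!andbA; apply/and4P; split; apply/cent1P/commute_sym/cs;
    rewrite !inE eqxx ?orbT.
have csgw : commute s (g * w) by apply: (centsP abD).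
by rewrite -[g](mulgK w); apply: commuteM => //; apply: commuteV.
Qed.

Lemma symplectic_quad_gen x y u v w :
    symplectic_quad x y u v -> w \in 'Z(G) -> w \notin <[z]> ->
  <[x]> <*> <[y]> <*> <[u]> <*> <[v]> <*> <[w]> = G.
Proof.
move=> qG Zw z'w; have [Gx Gy Gu Gv xy _ _ _ _ _] := qG.
have Gw : w \in G by case/setIP: Zw.
apply/eqP; rewrite eqEsubset !join_subG !cycle_subG Gx Gy Gu Gv Gw /=.
set J := <[x]> <*> _ <*> _ <*> _.
have sJ : J \subset J <*> <[w]> := joing_subl _ _.
have Jz : <[z]> \subset J <*> <[w]>.
  rewrite cycle_subG (subsetP sJ) // -xy.
  by apply: (subsetP (joing_subl _ _)); apply: (subsetP (joing_subl _ _));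
    rewrite groupR // mem_gen // inE cycle_id ?orbT.
have Jw : w \in J <*> <[w]> by rewrite mem_gen // inE cycle_id orbT.
apply/subsetP=> g Gg.
have [s [Js Gs]] := symplectic_quad_correct qG Gg.
rewrite (cent_symplectic_quad qG) => Zgs.
have Ks : s \in J <*> <[w]> := subsetP sJ _ Js.
rewrite -[g](mulgK s) groupM ?groupV //.
have [/(subsetP Jz)//|z'gs] := boolP (g * s \in <[z]>).
suffices: g * s * w \in J <*> <[w]> by rewrite groupMr.
by apply/(subsetP Jz)/mul_center_coset.
Qed.

(** The centre is the centralizer of four elements, each of which at most halves the order: |Z(G)|
    >= 64 / 2^4 = 4. *)
Lemma center_not_sub_cycle x y u v :
  symplectic_quad x y u v -> exists2 w, w \in 'Z(G) & w \notin <[z]>.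
Proof.
move=> qG; have [Gx Gy Gu Gv _ _ _ _ _ _] := qG.
apply/subsetPn/negP=> /subset_leq_card.
rewrite -[#|<[z]>|]/#[z] oz; apply/negP; rewrite -ltnNge.
have s1 : 'C_G[x] \subset G := subsetIl _ _.
have s2 : 'C_('C_G[x])[y] \subset G := subset_trans (subsetIl _ _) s1.
have s3 : 'C_('C_('C_G[x])[y])[u] \subset G := subset_trans (subsetIl _ _) s2.
have defZ : 'C_('C_('C_('C_G[x])[y])[u])[v] = 'Z(G).
  by rewrite -(cent_symplectic_quad qG) !centU !cent_set1 !setIA.
have := leq_cent1 s3 Gv; rewrite defZ => l4.
have := leq_trans (leq_cent1 s2 Gu) (leq_mul (leqnn 2) l4).
move/(leq_mul (leqnn 2))/(leq_trans (leq_cent1 s1 Gy)).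
move/(leq_mul (leqnn 2))/(leq_trans (leq_cent1 (subxx G) Gx)).
rewrite oG !mulnA (leq_pmul2l (m := 16) (n1 := 4)) //.
exact: leq_trans.
Qed.

(** * Normal forms of the square map *)

Lemma sqrM_mod_z a b :
  a \in G -> b \in G -> ((a * b) ^+ 2 \in <[z]>) = (a ^+ 2 * b ^+ 2 \in <[z]>).
Proof.
move=> Ga Gb; have zab : [~ a, b] \in <[z]> by rewrite -dG mem_commg.
by rewrite sqrM_der2 // groupMr.
Qed.

(** Two such elements differ by a power of [z], whose square is trivial. Hence one central [w]
    outside [<[z]>] decides whether the centre is cyclic. *)
Lemma sqr_center_coset c d :
    c \in 'Z(G) -> d \in 'Z(G) -> c \notin <[z]> -> d \notin <[z]> ->
  c ^+ 2 = d ^+ 2.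
Proof.
move=> Zc Zd z'c z'd.
have cd2 : c ^+ 2 * d ^+ 2 = 1.
  have cdC : commute c d.
    by apply/commgP/eqP; rewrite comm_Z //; case/setIP: Zc.
  rewrite -expgMn //; have := mul_center_coset Zc Zd z'c z'd.
  by rewrite mem_z => /orP[]/eqP->; rewrite ?expg1n.
have d4 : (d ^+ 2)^-1 = d ^+ 2.
  have := mul_center_coset Zd Zd z'd z'd; rewrite -[d * d]/(d ^+ 2) mem_z.
  by case/orP=> /eqP->; rewrite ?invg1.
by rewrite -d4; apply/eqP; rewrite eq_mulgV1 invgK cd2.
Qed.

Lemma quad_rels_symplectic a b c d e f x y u v w :
    symplectic_quad x y u v -> w \in 'Z(G) ->
    x ^+ 2 = z ^+ a -> y ^+ 2 = z ^+ b -> v ^+ 2 = z ^+ c -> w ^+ 2 = z ^+ d ->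
    u ^+ 2 = z ^+ e * w ^+ f ->
  quad_rels a b c d e f z x y u v w.
Proof. by move=> [? ? ? ? ? ? ? ? ? ?] Zw *; split; rewrite // comm_Z. Qed.

Lemma symplectic_quad_gen_sqr x y u v :
    symplectic_quad x y u v -> u ^+ 2 \notin <[z]> ->
  <[x]> <*> <[y]> <*> <[u]> <*> <[v]> = G.
Proof.
move=> qG z'u2; rewrite -joing_sqr; apply: (symplectic_quad_gen qG) => //.
by apply: sqr_center; case: qG.
Qed.

(* Squaring is linear modulo <z>, so the other three elements can be moved    *)
(* into its kernel.                                                           *)
Lemma symplectic_quad_sqr_out u :
    u \in G -> u ^+ 2 \notin <[z]> ->
  exists x y v, [/\ symplectic_quad x y u v, x ^+ 2 \in <[z]>,
    y ^+ 2 \in <[z]> & v ^+ 2 \in <[z]>].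
Proof.
move=> Gu z'u2.
have out2 a b : a \in G -> b \in G -> a ^+ 2 \notin <[z]> ->
    b ^+ 2 \notin <[z]> -> (a * b) ^+ 2 \in <[z]>.
  by move=> Ga Gb a2 b2; rewrite sqrM_mod_z // mul_center_coset ?sqr_center.
have [v [Gv uv v2]] : exists v, [/\ v \in G, [~ u, v] = z & v ^+ 2 \in <[z]>].
  have [v Gv uv] : exists2 v, v \in G & [~ u, v] = z.
    have z'u : u \notin <[z]> by apply: contra z'u2 => /groupX->.
    have: u \notin 'Z(G).
      by apply: contra z'u2 => Zu; apply: (mul_center_coset Zu Zu).
    rewrite inE Gu -sub_cent1 => /subsetPn[v Gv ncuv]; exists v => //.
    case: (commg_der2 Gu Gv) => // /eqP/commgP cuv.
    by case/cent1P: ncuv; apply: commute_sym.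
  have [v2|z'v2] := boolP (v ^+ 2 \in <[z]>); first by exists v.
  exists (u * v); rewrite groupM // commgM_der2 // uv commgg mulg1.
  by split=> //; apply: out2.
have [x [y qG]] := symplectic_quad_complete Gu Gv uv.
have fix_x x' y' : symplectic_quad x' y' u v -> x' ^+ 2 \notin <[z]> ->
    y' ^+ 2 \in <[z]> -> exists x y v, [/\ symplectic_quad x y u v,
    x ^+ 2 \in <[z]>, y ^+ 2 \in <[z]> & v ^+ 2 \in <[z]>].
  move=> q x2 y2; have [Gx Gy _ _ _ _ _ _ _ _] := q.
  exists (x' * u), y', (v * y'); split=> //.
  - exact: symplectic_quad_transvection.
  - exact: out2.
  by rewrite sqrM_mod_z // groupM.
have [Gx Gy _ _ _ _ _ _ _ _] := qG.
have [x2|x2] := boolP (x ^+ 2 \in <[z]>); have [y2|y2] := boolP (y ^+ 2 \in <[z]>).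
- by exists x, y, v.
- exact: fix_x (symplectic_quad_flip qG) y2 x2.
- exact: fix_x qG x2 y2.
(* If both squares lie outside, (xy)^2 falls back into [<[z]>]; the pair (y, xy) then has only its
   first square outside. *)
apply: (fix_x _ _ (symplectic_quad_flip (symplectic_quad_mul qG)) y2).
exact: out2.
Qed.

Lemma symplectic_quad_arf1 x y u v :
    symplectic_quad x y u v -> x ^+ 2 = 1 -> y ^+ 2 = z ->
  exists x' y', [/\ symplectic_quad x' y' u v, x' ^+ 2 = 1 & y' ^+ 2 = 1].
Proof.
move=> qG x2 y2; have [Gx Gy _ _ xy _ _ _ _ _] := qG.
exists x, (y * x); split=> //.
  exact/symplectic_quad_flip/symplectic_quad_mul/symplectic_quad_flip.
by rewrite sqrM_der2 // x2 y2 (commgC_der2 Gx Gy) xy mulg1 zz.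
Qed.

(** The Arf invariant of a plane: squares 1 and 1 give a dihedral group of order 8, [z] and [z] a
    quaternion group. A mixed pair is dihedral, because (yx)^2 is then 1. *)
Lemma symplectic_quad_arf x y u v :
    symplectic_quad x y u v -> x ^+ 2 \in <[z]> -> y ^+ 2 \in <[z]> ->
  exists x' y', symplectic_quad x' y' u v /\
    (x' ^+ 2 = 1 /\ y' ^+ 2 = 1 \/ x' ^+ 2 = z /\ y' ^+ 2 = z).
Proof.
rewrite !mem_z => qG /orP[]/eqP x2 /orP[]/eqP y2.
- by exists x, y; split; [|left].
- have [x' [y' [q' x'2 y'2]]] := symplectic_quad_arf1 qG x2 y2.
  by exists x', y'; split; [|left].
- have [x' [y' [q' x'2 y'2]]] :=
    symplectic_quad_arf1 (symplectic_quad_flip qG) y2 x2.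
  by exists x', y'; split; [|left].
by exists x, y; split; [|right].
Qed.

Lemma symplectic_quad_centers c1 c2 c3 c4 x y u v :
    c1 \in 'Z(G) -> c2 \in 'Z(G) -> c3 \in 'Z(G) -> c4 \in 'Z(G) ->
    symplectic_quad x y u v ->
  symplectic_quad (x * c1) (y * c2) (u * c3) (v * c4).
Proof.
move=> Z1 Z2 Z3 Z4 qG.
apply/(symplectic_quad_center Z1)/symplectic_quad_flip.
apply/(symplectic_quad_center Z2)/symplectic_quad_flip/symplectic_quad_swap.
apply/(symplectic_quad_center Z3)/symplectic_quad_flip.
exact/(symplectic_quad_center Z4)/symplectic_quad_flip/symplectic_quad_swap.
Qed.

(** A central [w] with square [z] exchanges the two possible squares, so no Arf invariant survives
    when the centre is cyclic. *)
Lemma sqr_adjust w a t :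
    w \in 'Z(G) -> w ^+ 2 = z -> a \in G -> a ^+ 2 \in <[z]> -> t \in <[z]> ->
  exists2 c, c \in 'Z(G) & (a * c) ^+ 2 = t.
Proof.
move=> Zw w2 Ga; rewrite !mem_z.
have [Gw _] := setIP Zw; have aw2 : (a * w) ^+ 2 = a ^+ 2 * z.
  by rewrite sqrM_der2 // w2 comm_Z // mulg1.
case/orP=> /eqP a2 /orP[]/eqP->.
- by exists 1; rewrite ?group1 // mulg1.
- by exists w; rewrite // aw2 a2 mul1g.
- by exists w; rewrite // aw2 a2 zz.
by exists 1; rewrite ?group1 // mulg1.
Qed.

(** Squares in [<[z]>] can be prescribed at will, so the only invariant is whether some square
    leaves [<[z]>]: 249 if so, 266 if not. *)
Lemma isog_G64_center4 w x y u v :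
    w \in 'Z(G) -> w \notin <[z]> -> w ^+ 2 = z -> symplectic_quad x y u v ->
  isog_G64 G 249 \/ isog_G64 G 266.
Proof.
move=> Zw z'w w2 q0.
have z0 : 1 \in <[z]> := group1 _; have z1 : z \in <[z]> := cycle_id z.
have [/existsP[u' /andP[Gu' z'u2]]|] :=
  boolP [exists u, (u \in G) && (u ^+ 2 \notin <[z]>)].
  left; have [x' [y' [v' [qG x2 y2 v2]]]] := symplectic_quad_sqr_out Gu' z'u2.
  have [Gx Gy _ Gv _ _ _ _ _ _] := qG.
  have [c1 Z1 {}x2] := sqr_adjust Zw w2 Gx x2 z1.
  have [c2 Z2 {}y2] := sqr_adjust Zw w2 Gy y2 z1.
  have [c4 Z4 {}v2] := sqr_adjust Zw w2 Gv v2 z0.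
  have := symplectic_quad_centers Z1 Z2 (group1 'Z(G)) Z4 qG.
  rewrite mulg1 => {}qG; have Zu2 := sqr_center Gu'.
  apply: isog_G64_249 oG (symplectic_quad_gen_sqr qG z'u2) _.
  apply: (quad_rels_symplectic qG Zu2); rewrite ?mul1g //.
  by rewrite (sqr_center_coset Zu2 Zw).
rewrite negb_exists => /forallP sq; right.
have {}sq a : a \in G -> a ^+ 2 \in <[z]>.
  by move=> Ga; have:= sq a; rewrite Ga negbK.
have [Gx Gy Gu Gv _ _ _ _ _ _] := q0.
have [c1 Z1 x2] := sqr_adjust Zw w2 Gx (sq x Gx) z0.
have [c2 Z2 y2] := sqr_adjust Zw w2 Gy (sq y Gy) z0.
have [c3 Z3 u2] := sqr_adjust Zw w2 Gu (sq u Gu) z0.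
have [c4 Z4 v2] := sqr_adjust Zw w2 Gv (sq v Gv) z0.
have qG := symplectic_quad_centers Z1 Z2 Z3 Z4 q0.
apply: isog_G64_266 oG (symplectic_quad_gen qG Zw z'w) _.
by apply: quad_rels_symplectic qG Zw _ _ _ _ _; rewrite ?mul1g.
Qed.

(** If some square leaves [<[z]>], the type of the plane of [x] and [y] and the value of v^2 give
    199, 200 and 201, the quaternion case with v^2 = z reducing to 201. Otherwise the total Arf
    invariant separates 264 from 265. *)
Lemma isog_G64_center22 w x y u v :
    w \in 'Z(G) -> w \notin <[z]> -> w ^+ 2 = 1 -> symplectic_quad x y u v ->
  exists2 t, t \in [:: 199; 200; 201; 264; 265] & isog_G64 G t.
Proof.
move=> Zw z'w w2 q0.
have [/existsP[u' /andP[Gu' z'u2]]|] :=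
  boolP [exists u, (u \in G) && (u ^+ 2 \notin <[z]>)].
  have [x' [y' [v' [q' x2' y2' v2]]]] := symplectic_quad_sqr_out Gu' z'u2.
  have [x1 [y1 [qG xy2]]] := symplectic_quad_arf q' x2' y2'.
  have u4 t : t \in G -> t ^+ 2 \notin <[z]> -> t ^+ 2 ^+ 2 = 1.
    by move=> Gt z't; rewrite (sqr_center_coset (sqr_center Gt) Zw).
  have [Gx Gy _ Gv xy uv xu xv yu yv] := qG.
  move: v2; rewrite mem_z => /orP[]/eqP v2.
    case: xy2 => [[x2 y2]|[x2 y2]].
      exists 199 => //; apply: isog_G64_199 oG (symplectic_quad_gen_sqr qG z'u2) _.
      apply: quad_rels_symplectic qG (sqr_center Gu') _ _ _ _ _;
        by rewrite ?mul1g ?u4.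
    exists 200 => //; apply: isog_G64_200 oG (symplectic_quad_gen_sqr qG z'u2) _.
    apply: quad_rels_symplectic qG (sqr_center Gu') _ _ _ _ _;
      by rewrite ?mul1g ?u4.
  have is201 a b c d : symplectic_quad a b c d -> a ^+ 2 = 1 -> b ^+ 2 = 1 ->
      c ^+ 2 \notin <[z]> -> d ^+ 2 = z ->
    exists2 t, t \in [:: 199; 200; 201; 264; 265] & isog_G64 G t.
    move=> q a2 b2 c2 d2; exists 201 => //; have Gc := sq_u q.
    apply: isog_G64_201 oG (symplectic_quad_gen_sqr q c2) _.
    apply: quad_rels_symplectic q (sqr_center Gc) _ _ _ _ _;
      by rewrite ?mul1g ?u4.
  case: xy2 => [[x2 y2]|[x2 y2]]; first exact: is201 qG x2 y2 z'u2 v2.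
  (* Replacing [x1] by x1 v' and [u'] by u' y1 makes the quaternion plane dihedral; [v'] is
     unchanged and the square of u' y1 still lies outside [<[z]>]. *)
  have q2 := symplectic_quad_swap (symplectic_quad_flip (symplectic_quad_swap qG)).
  have := symplectic_quad_swap (symplectic_quad_flip
    (symplectic_quad_swap (symplectic_quad_transvection q2))).
  move=> {}q2; have xv2 : (x1 * v') ^+ 2 = 1.
    by rewrite sqrM_der2 // x2 v2 xv zz mulg1.
  have [a [b [q3 a2 b2]]] := symplectic_quad_arf1 q2 xv2 y2.
  apply: is201 q3 a2 b2 _ v2.
  by rewrite sqrM_mod_z // y2 groupMr // cycle_id.
rewrite negb_exists => /forallP sq.
have {}sq a : a \in G -> a ^+ 2 \in <[z]>.
  by move=> Ga; have:= sq a; rewrite Ga negbK.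
have is264 a b c d : symplectic_quad a b c d -> a ^+ 2 = 1 -> b ^+ 2 = 1 ->
    c ^+ 2 = 1 -> d ^+ 2 = 1 ->
  exists2 t, t \in [:: 199; 200; 201; 264; 265] & isog_G64 G t.
  move=> q a2 b2 c2 d2; exists 264 => //.
  apply: isog_G64_264 oG (symplectic_quad_gen q Zw z'w) _.
  by apply: quad_rels_symplectic q Zw _ _ _ _ _; rewrite ?mul1g.
have is265 a b c d : symplectic_quad a b c d -> a ^+ 2 = 1 -> b ^+ 2 = 1 ->
    c ^+ 2 = z -> d ^+ 2 = z ->
  exists2 t, t \in [:: 199; 200; 201; 264; 265] & isog_G64 G t.
  move=> q a2 b2 c2 d2; exists 265 => //.
  apply: isog_G64_265 oG (symplectic_quad_gen q Zw z'w) _.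
  by apply: quad_rels_symplectic q Zw _ _ _ _ _; rewrite ?mulg1.
have [x1 [y1 [q1 xy2]]] := symplectic_quad_arf q0 (sq x (sq_x q0)) (sq y (sq_y q0)).
have := symplectic_quad_arf (symplectic_quad_swap q1)
  (sq u (sq_u q1)) (sq v (sq_v q1)).
case=> u1 [v1 [/symplectic_quad_swap qG uv2]].
have [Gx Gy Gu Gv xy uv xu xv yu yv] := qG.
case: xy2 uv2 => [[x2 y2]|[x2 y2]] [[u2 v2]|[u2 v2]].
- exact: is264 qG x2 y2 u2 v2.
- exact: is265 qG x2 y2 u2 v2.
- exact: is265 (symplectic_quad_swap qG) u2 v2 x2 y2.
(* Two quaternion planes are equivalent to two dihedral ones: after mixing, the squares are 1, z and
   z, 1, so each plane has a mixed pair. *)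
have xu2 : (x1 * u1) ^+ 2 = 1 by rewrite sqrM_der2 // x2 u2 xu zz mulg1.
have vy2 : (v1 * y1) ^+ 2 = 1.
  by rewrite sqrM_der2 // v2 y2 (commgC_der2 Gy Gv) yv zz mulg1.
have q2 := symplectic_quad_transvection qG.
have [a [b [q3 a2 b2]]] := symplectic_quad_arf1 q2 xu2 y2.
have := symplectic_quad_arf1 (symplectic_quad_flip (symplectic_quad_swap q3)) vy2 u2.
case=> c [d [/symplectic_quad_swap q4 c2 d2]].
exact: is264 q4 a2 b2 c2 d2.
Qed.

End Classification.

(** * Monolithicity and the structure of the centre *)

Lemma monolithicP (gT : finGroupType) (G : {group gT}) :
    G :!=: 1 ->
  reflect (exists2 s, s != 1 &
             forall N : {group gT}, N <| G -> N :!=: 1 -> s \in N)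
          (monolithic G).
Proof.
move=> ntG; have mon1 : 1 \in mon G.
  by rewrite inE group1; apply/bigcapP=> N _; apply: group1.
rewrite /monolithic eqEsubset sub1set mon1 andbT.
apply: (iffP subsetPn) => [[s]|[s nts mon_s]].
  rewrite !inE => /andP[Gs /bigcapP mon_s] nts; exists s => // N nNG ntN.
  by apply: mon_s; rewrite nNG.
exists s; rewrite !inE // mon_s ?normal_refl //.
by apply/bigcapP=> N /andP[]; apply: mon_s.
Qed.

Theorem theoremA (gT : finGroupType) (G : {group gT})
    (oG : #|G| = 64) (dksG : admits_diagonal_dks G) :
  (~~ monolithic G ->
     exists2 t : nat, t \in [:: 199; 200; 201; 264; 265] & isog_G64 G t) /\
  (monolithic G ->
     exists2 t : nat, t \in [:: 249; 266] & isog_G64 G t).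
Proof.
have [z [oz Zz dG oZ]] := diagonal_dks_structure oG dksG.
have ntG : G :!=: 1 by rewrite -cardG_gt1 oG.
have pG : 2.-group G by rewrite /pgroup oG.
have ntz : z != 1 by rewrite -order_gt1 oz.
have mem_z s : (s \in <[z]>) = (s == 1) || (s == z) by rewrite cycle2g // !inE.
have: ~~ abelian G.
  by apply/derG1P/eqP; rewrite dG cycle_eq1.
case/subsetPn=> u Gu; rewrite -sub_cent1 => /subsetPn[v Gv cuv].
have [uv|uv] := commg_der2 oz dG Gu Gv.
  by case/cent1P: cuv; apply/commute_sym/commgP/eqP.
have [x [y qG]] := symplectic_quad_complete oG oz Zz dG oZ Gu Gv uv.
have [w Zw z'w] := center_not_sub_cycle oG oz Zz dG qG.
have [Gw cGw] := setIP Zw.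
have: w * w \in <[z]> by exact: (mul_center_coset oz Zz oZ Zw Zw z'w z'w).
rewrite mem_z => /orP[]/eqP w2.
  (* If w^2 = 1, then [<[z]>] and [<[w]>] are distinct normal subgroups of order two, so their
     intersection is trivial. *)
  suffices nmonG : ~~ monolithic G.
    split=> [_|monG]; last by rewrite monG in nmonG.
    exact: (isog_G64_center22 oG oz Zz dG oZ Zw z'w w2 qG).
  apply/(monolithicP ntG) => -[s nts mon_s].
  have ntw : w != 1 by apply: contraNneq z'w => ->; apply: group1.
  have [zs ws] : s \in <[z]> /\ s \in <[w]>.
    by split; apply: mon_s; rewrite ?sub_center_normal ?cycle_subG ?cycle_eq1.
  have ow : #[w] = 2 by apply: nt_prime_order.
  case/negP: z'w; move: ws.
  by rewrite cycle2g // !inE (negPf nts) => /eqP<-.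
(* If w^2 = z, the centre is cyclic of order 4. A nontrivial normal subgroup of a nilpotent group
   meets the centre nontrivially, hence contains [z]. *)
have monG : monolithic G.
  apply/(monolithicP ntG); exists z => // N nNG ntN.
  have: N :&: 'Z(G) != 1 by rewrite meet_center_nil ?(pgroup_nil pG).
  case/trivgPn=> s /setIP[Ns Zs] nts.
  have [|z's] := boolP (s \in <[z]>).
    by rewrite mem_z (negPf nts) => /eqP<-.
  have <- : s ^+ 2 = z by rewrite (sqr_center_coset oz Zz oZ Zs Zw z's z'w).
  exact: groupX.
split=> [|_]; first by rewrite monG.
case: (isog_G64_center4 oG oz Zz dG oZ Zw z'w w2 qG) => isoG.
  by exists 249.
by exists 266.
Qed.
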